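(* Let $\Gamma\in\mathbb{C}^{d_1\times\cdots\times d_\ell}$ be an $\ell$-tensor over $\mathbb{C}$ with modes $U_a=\mathbb{C}^{d_a}$, and let $\mathcal{C}_{\mathrm{uni}}=[\,1\ 1\ \cdots\ 1\,]$ be the universal chisel with $\ell$ columns. The following hold. (a) Let $(D_a : a\in[\ell])$ be a $\mathcal{C}_{\mathrm{uni}}$-derivation of $\Gamma$. For each $a\in[\ell]$, the operator $D_a$ can be decomposed as $D_a=S_a+N_a$, where $S_a$ is diagonalizable, $N_a$ is nilpotent, $S_a$ and $N_a$ commute, and any two such decompositions are conjugate under an invertible operator on $U_a$. Furthermore, both $(S_a : a\in[\ell])$ and $(N_a : a\in[\ell])$ are $\mathcal{C}_{\mathrm{uni}}$-derivations of $\Gamma$. (b) Let $(D_a : a\in[\ell])$ and $(E_a : a\in[\ell])$ be $\mathcal{C}_{\mathrm{uni}}$-derivations of $\Gamma$ such that all $D_a$ and all $E_a$ are diagonalizable. Then for each $a\in[\ell]$ there are invertible matrices $X_a$ (invertible operators on $U_a$) such that $(X_a^{-1}E_aX_a : a\in[\ell])$ is a $\mathcal{C}_{\mathrm{uni}}$-derivation of $\Gamma$, and, for each $a\in[\ell]$, $D_a$ and $X_a^{-1}E_aX_a$ are simultaneously diagonalizable.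
   Context: $[k]=\{1,\ldots,k\}$. An $\ell$-tensor over $\mathbb{C}$ is an array $\Gamma\in\mathbb{C}^{d_1\times\cdots\times d_\ell}$, with modes $U_a=\mathbb{C}^{d_a}$ for $a\in[\ell]$, interpreted as the multilinear form $U_1\times\cdots\times U_\ell\to\mathbb{C}$ given by $$\langle\Gamma\mid u_1,\ldots,u_\ell\rangle=\sum_{i_1\in[d_1]}\cdots\sum_{i_\ell\in[d_\ell]}\Gamma_{i_1\cdots i_\ell}\,u_{1i_1}\cdots u_{\ell i_\ell}.$$ A tuple $(D_1,\ldots,D_\ell)$ of linear operators $D_a:U_a\to U_a$ is a $\mathcal{C}_{\mathrm{uni}}$-derivation of $\Gamma$ if for all $(u_1,\ldots,u_\ell)\in U_1\times\cdots\times U_\ell$, $$\sum_{a=1}^{\ell}\langle\Gamma\mid u_1,\ldots,u_{a-1},D_au_a,u_{a+1},\ldots,u_\ell\rangle=0.$$ *)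

(* Defs.v *)
From mathcomp Require Import all_boot all_order all_algebra.
From mathcomp Require Import reals.
From mathcomp.real_closed Require Import complex.

Set Implicit Arguments.
Unset Strict Implicit.
Unset Printing Implicit Defensive.

Import GRing.Theory.
Local Open Scope ring_scope.

(* An l-tensor with modes K^(d a), a : 'I_l, is its array of coefficients,
   indexed by the dependent tuples of [d 0] x ... x [d (l-1)]. *)
Definition tensor (K : fieldType) (l : nat) (d : 'I_l -> nat) : Type :=
  {dffun forall a : 'I_l, 'I_(d a)} -> K.

Definition tensor_form (K : fieldType) (l : nat) (d : 'I_l -> nat)
    (Gamma : tensor K d) (u : forall a : 'I_l, 'cV[K]_(d a)) : K :=
  \sum_(i : {dffun forall a : 'I_l, 'I_(d a)})
    Gamma i * \prod_(a < l) u a (i a) 0.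

(* [dfwith u v] is the family u with its entry at the index of v replaced
   by v; operators act on column vectors on the left. *)
Definition uni_derivation (K : fieldType) (l : nat) (d : 'I_l -> nat)
    (Gamma : tensor K d) (D : forall a : 'I_l, 'M[K]_(d a)) : Prop :=
  forall u : forall a : 'I_l, 'cV[K]_(d a),
    \sum_(a < l) tensor_form Gamma (dfwith u (D a *m u a)) = 0.

Definition nilpotent_mx (K : fieldType) (n : nat) (N : 'M[K]_n) : Prop :=
  exists k : nat, N ^+ k = 0.

Definition jordan_chevalley (K : fieldType) (n : nat)
    (D S N : 'M[K]_n) : Prop :=
  [/\ D = S + N, diagonalizable S, nilpotent_mx N & comm_mx S N].

(* Main.v *)
Require Import Defs.
From mathcomp Require Import all_boot all_order all_algebra perm.
From mathcomp Require Import reals boolp.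
From mathcomp.real_closed Require Import complex.
From mathcomp Require Import mpoly ring zify.

(** Part (a). Over an algebraically closed field the semisimple part of a matrix
D is a polynomial s(D), where s takes the value x modulo a high power of
['X - x%:P] for each eigenvalue x ([poly_crt]). Hence it commutes with all
that commutes with D; two decompositions of D then differ by a matrix that is
both diagonalizable and nilpotent, that is, by 0. So the decomposition is
unique and the conjugating operator can be the identity. For the last claim,
take eigenvectors u_a of the S_a, with eigenvalues c_a. The derivation identity
turns (sum of the c_a) * Gamma(u) into terms in which some u_a is replaced by
N_a u_a; iterating, these vanish, so Gamma(u) = 0 unless the c_a sum to 0
([form_eigenvectors]). This says that S, and so N = D - S, is a derivation.

Part (b). The derivations of Gamma form a Lie algebra L which contains the
Jordan parts of its elements, and the claim is a case of the conjugacy of its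
maximal tori. Only spectra matter here: it is enough to find a derivation V
which commutes with D, is diagonalizable, and has in each mode the same
characteristic polynomial as E, for then V_a is conjugate to E_a.

In a well-chosen basis D is diagonal and there is a diagonal derivation t with
as many distinct eigenvalues as possible ([exists_regular]). By maximality
every semisimple derivation commuting with t is diagonal and constant on the
eigenspaces of t ([is_regular]); in particular D is of this form, and V will be
diagonal in the same basis. For x in the centralizer L_0 of t in L, the
semisimple part of x is then obtained by averaging the diagonal of x over the
eigenspaces of t: the spectrum of x is a linear function of x, and it is the
diagonal of a derivation ([centralizer_spectrum]).

Next, E is deformed to t along x(T) = t + T (E - t), where T is an
indeterminate. Since L is the sum of L_0 and [t, L], conjugations by
exponentials of elements of T^k L[T] move x(T) into L_0[T] modulo any power of
T ([centralizer_normal_form]). So modulo every power of T the roots of the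
characteristic polynomials of x(T) can be labelled so that they are the diagonal
entries of a derivation, i.e. satisfy the linear relations given by the
nonzero coefficients of Gamma. Symmetrising these relations over all labellings
gives, by the fundamental theorem of symmetric polynomials, a polynomial in T
which vanishes modulo every power of T, hence vanishes at T = 1
([specialize_root_relations]). Thus some labelling of the eigenvalues of E
satisfies the relations, and is the diagonal of the required V
([torus_spectrum]). *)

Set Implicit Arguments.
Unset Strict Implicit.
Unset Printing Implicit Defensive.

Import GRing.Theory Num.Theory.
Local Open Scope ring_scope.

(** * Jordan-Chevalley decomposition of a matrix *)

Lemma invmx_mul (R : comUnitRingType) (n : nat) (A B : 'M[R]_n) :
  A \in unitmx -> B \in unitmx -> invmx (A *m B) = invmx B *m invmx A.
Proof.
move=> Au Bu; have ABu : A *m B \in unitmx by rewrite unitmx_mul Au.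
apply: (can_inj (mulKmx ABu)); rewrite mulmxV// mulmxA mulmxK//.
by rewrite mulmxV.
Qed.

Lemma diagonalizable_ex (F : fieldType) (n : nat) (A : 'M[F]_n) :
  diagonalizable A <->
  exists P : 'M[F]_n, P \in unitmx /\
    exists t : 'rV[F]_n, A = invmx P *m diag_mx t *m P.
Proof.
split=> [[P Pu /(diagonalizable_forLR Pu)[t ->]]|[P [Pu [t ->]]]].
  by exists P; split=> //; exists t; rewrite mxpoly.conjVmx.
by exists P => //; apply/(diagonalizable_forLR Pu); exists t; rewrite mxpoly.conjVmx.
Qed.

Lemma diagonalizable_conj (F : fieldType) (n : nat) (A P : 'M[F]_n) :
  P \in unitmx -> diagonalizable A -> diagonalizable (P *m A *m invmx P).
Proof.
move=> Pu /diagonalizable_ex[Q [Qu [t ->]]].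
apply/diagonalizable_ex; exists (Q *m invmx P).
rewrite unitmx_mul Qu unitmx_inv Pu; split=> //; exists t.
by rewrite invmx_mul ?unitmx_inv// invmxK !mulmxA.
Qed.

Lemma codiagonalizable_ex (F : fieldType) (n : nat) (As : seq 'M[F]_n) :
  {in As &, forall A B, comm_mx A B} -> {in As, forall A, diagonalizable A} ->
  exists P : 'M[F]_n, P \in unitmx /\
    {in As, forall A, exists t : 'rV[F]_n, A = invmx P *m diag_mx t *m P}.
Proof.
move=> cA dA; have /codiagonalizableP[P Pu /allP dP] := conj cA dA.
exists P; split=> // A /dP /(diagonalizable_forLR Pu)[t ->].
by exists t; rewrite mxpoly.conjVmx.
Qed.

Lemma conj_diag_eq0 (F : fieldType) (n : nat) (P : 'M[F]_n) (t : 'rV[F]_n) :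
  P \in unitmx -> invmx P *m diag_mx t *m P = 0 -> t = 0.
Proof.
move=> Pu /(congr1 (fun A => P *m A *m invmx P)).
rewrite !mulmxA mulmxV// mul1mx mulmxK// mulmx0 mul0mx => /matrixP t0.
by apply/rowP => i; have := t0 i i; rewrite !mxE eqxx.
Qed.

Lemma expr_conj_diag (F : fieldType) (n : nat) (P : 'M[F]_n) (t : 'rV[F]_n) k :
  P \in unitmx ->
  (invmx P *m diag_mx t *m P) ^+ k =
  invmx P *m diag_mx (\row_i t 0 i ^+ k) *m P.
Proof.
move=> Pu; elim: k => [|k IHk].
  rewrite expr0 (_ : \row_i _ = const_mx 1).
    by rewrite diag_const_mx mulmx1 mulVmx.
  by apply/rowP => i; rewrite !mxE expr0.
rewrite exprS IHk -mulmxE !mulmxA mulmxK//.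
rewrite -(mulmxA (invmx P)) mulmx_diag; congr (_ *m diag_mx _ *m _).
by apply/rowP => i; rewrite !mxE exprS.
Qed.

Lemma diagonalizable_nilpotent (F : fieldType) (n : nat) (A : 'M[F]_n) :
  diagonalizable A -> nilpotent_mx A -> A = 0.
Proof.
move=> /diagonalizable_ex[P [Pu [t ->]]] [k].
rewrite expr_conj_diag// => /(conj_diag_eq0 Pu)/rowP t0.
rewrite (_ : t = 0) ?linear0 ?mulmx0 ?mul0mx//.
apply/rowP => i; have := t0 i; rewrite !mxE => /eqP.
by rewrite expf_eq0 => /andP[_ /eqP].
Qed.

(** Each term of the binomial expansion of exponent p + q contains A at least
p times or B at least q times. *)
Lemma nilpotent_sub (F : fieldType) (n : nat) (A B : 'M[F]_n) :
  comm_mx A B -> nilpotent_mx A -> nilpotent_mx B -> nilpotent_mx (A - B).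
Proof.
move=> cAB [p Ap] [q Bq]; exists (p + q)%N.
have cANB : GRing.comm A (- B) by apply: commrN.
rewrite exprDn_comm// big1// => i _.
have [le_pi|lt_ip] := leqP q i.
  have Bi : B ^+ i = 0 by rewrite -(subnKC le_pi) exprD Bq mul0r.
  by rewrite exprNn Bi !mulr0 mul0rn.
have ple : (p <= p + q - i)%N by rewrite -addnBA ?leq_addr// ltnW.
have Ai : A ^+ (p + q - i) = 0 by rewrite -(subnKC ple) exprD Ap mul0r.
by rewrite Ai mul0r mul0rn.
Qed.

(** Chinese remainders, one root at a time: if u Q + v R = 1, where Q is the
modulus already treated and R the new one, adding u Q (y - s) corrects s
modulo R only. *)
Lemma poly_crt (F : fieldType) (k : nat) (rs : seq F) :
  uniq rs -> exists s : {poly F},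
    {in rs, forall x, ('X - x%:P) ^+ k %| s - x%:P}.
Proof.
elim: rs => [|y rs IHrs] /=; first by exists 0.
move=> /andP[yrs /IHrs[s sP]].
pose Q := \prod_(x <- rs) ('X - x%:P) ^+ k.
have /Bezout_eq1_coprimepP[[u v] /= uv1] : coprimep Q (('X - y%:P) ^+ k).
  rewrite /Q big_seq; elim/big_rec: _ => [|x q xrs cq]; first exact: coprime1p.
  rewrite coprimepMl cq andbT coprimep_expr// coprimep_expl// coprimep_XsubC root_XsubC.
  by apply: contraNneq yrs => ->.
exists (s + u * Q * (y%:P - s)) => x.
rewrite inE => /predU1P[->|xrs].
  have -> : s + u * Q * (y%:P - s) - y%:P =
            (u * Q - 1) * (y%:P - s) by ring.
  have -> : u * Q - 1 = - (v * ('X - y%:P) ^+ k).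
    by rewrite -uv1; ring.
  by rewrite mulNr dvdpNr -mulrA dvdp_mull// dvdp_mulr.
have -> : s + u * Q * (y%:P - s) - x%:P = (s - x%:P) + Q * (u * (y%:P - s)).
  by ring.
rewrite dvdp_add ?sP// dvdp_mulr// /Q (big_rem x)//= dvdp_mulr//.
Qed.

(** The semisimple part is s(D), with s from [poly_crt] for the eigenvalues of
D. The product of the s - x vanishes at D, so s(D) has a minimal polynomial
with simple roots; 'X - s vanishes at each eigenvalue, so D - s(D) is
nilpotent. *)
Lemma jordan_chevalley_exists (F : closedFieldType) (n : nat) (D : 'M[F]_n) :
  exists S : 'M[F]_n, jordan_chevalley D S (D - S) /\
    forall A : 'M[F]_n, comm_mx A D -> comm_mx A S.
Proof.
case: n D => [|n] D.
  exists 0; rewrite subr0; split; last by move=> A _; apply: comm_mx0.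
  split; first by rewrite add0r.
  + exact: diagonalizable0.
  + by exists 0; rewrite expr0 !flatmx0.
  + exact: comm0mx.
have [r chD] := closed_field_poly_normal (char_poly D).
have := char_poly_monic D; rewrite monicE => /eqP lD.
rewrite lD scale1r in chD.
pose rs := undup r; pose P := \prod_(x <- rs) ('X - x%:P).
(* Each of the size r linear factors of char_poly D divides P. *)
have chP k : (size r <= k)%N -> char_poly D %| P ^+ k.
  move=> lek; rewrite chD -(subnKC lek) exprD dvdp_mulr//.
  rewrite big_seq.
  have -> : P ^+ size r = \prod_(i <- r | i \in r) P.
    by rewrite -big_seq big_const_seq count_predT -Monoid.iteropE.
  elim/big_rec2: _ => // x p q xr pq; rewrite dvdp_mul//.
  have xrs : x \in rs by rewrite mem_undup.
  by rewrite /P (big_rem x)//= dvdp_mulr.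
(* The successor makes k positive, so that s takes the value x at each x. *)
pose k := (size r).+1.
have [s sP] := poly_crt k (undup_uniq r).
have hD0 p : char_poly D %| p -> horner_mx D p = 0.
  by move=> /dvdpP[q ->]; rewrite rmorphM /= Cayley_Hamilton mulr0.
have cS A : comm_mx A D -> comm_mx A (horner_mx D s) by apply: comm_mx_horner.
exists (horner_mx D s); split=> //; split.
- by rewrite addrC subrK.
- apply/diagonalizableP; exists rs; first exact: undup_uniq.
  apply: mxminpoly_min; rewrite rmorph_prod /=.
  rewrite (eq_bigr (fun x => horner_mx D (s - x%:P))); last first.
    by move=> x _; rewrite !rmorphB /= horner_mx_X !horner_mx_C.
  rewrite -rmorph_prod; apply: hD0; apply: dvdp_trans (chP k (leqnSn _)) _.
  rewrite -prodrXl big_seq [X in _ %| X]big_seq.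
  by elim/big_rec2: _ => // x p q xrs pq; rewrite dvdp_mul// sP.
- exists k.
  have -> : D - horner_mx D s = horner_mx D ('X - s).
    by rewrite rmorphB /= horner_mx_X.
  rewrite -rmorphXn; apply: hD0; apply: dvdp_trans (chP k (leqnSn _)) _.
  apply: dvdp_exp2r; apply: uniq_roots_dvdp; last first.
    by rewrite uniq_rootsE undup_uniq.
  apply/allP => x xrs; rewrite /root !hornerE subr_eq0 eq_sym.
  rewrite -subr_eq0 -[X in _ - X](hornerC x x) -hornerN -hornerD.
  rewrite -[_ == 0]/(root _ x) -dvdp_XsubCl.
  by apply: dvdp_trans (sP x xrs); rewrite exprS dvdp_mulr.
- apply: comm_mxB; last by [].
  by apply/comm_mx_sym/cS.
Qed.

(** Both S and N commute with D, hence with s(D); so S - s(D) is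
diagonalizable and, being (D - s(D)) - N, also nilpotent. *)
Lemma jordan_chevalley_unique (F : closedFieldType) (n : nat)
    (D S N S' N' : 'M[F]_n) :
  jordan_chevalley D S N -> jordan_chevalley D S' N' -> S = S' /\ N = N'.
Proof.
have [S0 [[_ dS0 nN0 _] cS0]] := jordan_chevalley_exists D.
have main S1 N1 : jordan_chevalley D S1 N1 -> S1 = S0.
  move=> [defD dS nN cSN].
  have cSD : comm_mx S1 D by rewrite defD; apply: comm_mxD.
  have cND : comm_mx N1 D by rewrite defD; apply: comm_mxD; [apply/comm_mx_sym|].
  have cSS0 := cS0 _ cSD; have cNS0 := cS0 _ cND.
  have nil : nilpotent_mx (S1 - S0).
    have -> : S1 - S0 = (D - S0) - N1 by rewrite defD addrAC addrK.
    apply: nilpotent_sub => //; apply/comm_mx_sym.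
    by apply: comm_mxB.
  apply/eqP; rewrite -subr_eq0; apply/eqP; apply: diagonalizable_nilpotent nil.
  have [||P [Pu dP]] := @codiagonalizable_ex F n [:: S1; S0].
  - move=> A B; rewrite !inE => /orP[]/eqP-> /orP[]/eqP->;
      by [apply: comm_mx_refl | | apply: comm_mx_sym].
  - by move=> A; rewrite !inE => /orP[]/eqP->.
  have [|t ->] := dP S1; first by rewrite inE eqxx.
  have [|t' ->] := dP S0; first by rewrite !inE eqxx orbT.
  apply/diagonalizable_ex; exists P; split=> //; exists (t - t').
  by rewrite linearB /= mulmxBr mulmxBl.
move=> jc jc'; have eS := main _ _ jc; have eS' := main _ _ jc'.
split; first by rewrite eS.
case: jc jc' => [defD _ _ _] [defD' _ _ _].
by move: defD'; rewrite defD eS eS' => /addrI.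
Qed.

Lemma jordan_chevalley_comm (F : closedFieldType) (n : nat)
    (D S N A : 'M[F]_n) :
  jordan_chevalley D S N -> comm_mx A D -> comm_mx A S.
Proof.
move=> jc; have [S0 [jc0 cS0]] := jordan_chevalley_exists D.
by have [-> _] := jordan_chevalley_unique jc jc0; apply: cS0.
Qed.

(** * Derivations in coordinates *)

Notation multi_index d := {dffun forall a, 'I_(d a)}.

Definition set_coord (l : nat) (d : 'I_l -> nat) (i : multi_index d) (a : 'I_l)
    (j : 'I_(d a)) : multi_index d :=
  [ffun b => dfwith i j b].

Section Update.
Variables (l : nat) (d : 'I_l -> nat).
Implicit Types (i : multi_index d) (a b : 'I_l).

Lemma set_coord_in i a (j : 'I_(d a)) : set_coord i j a = j.
Proof. by rewrite ffunE dfwith_in. Qed.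

Lemma set_coord_out i a (j : 'I_(d a)) b : a != b -> set_coord i j b = i b.
Proof. by move=> ab; rewrite ffunE dfwith_out. Qed.

Lemma set_coord_id i a : set_coord i (i a) = i.
Proof. by apply/ffunP => b; rewrite ffunE; case: dfwithP. Qed.

Lemma set_coord_twice i a (j k : 'I_(d a)) : set_coord (set_coord i j) k = set_coord i k.
Proof.
apply/ffunP => b; have [<-|ab] := eqVneq a b; first by rewrite !set_coord_in.
by rewrite !set_coord_out.
Qed.

Lemma set_coord_comm i a (j : 'I_(d a)) b (k : 'I_(d b)) :
  a != b -> set_coord (set_coord i j) k = set_coord (set_coord i k) j.
Proof.
move=> ab; apply/ffunP => c; have [<-|bc] := eqVneq b c.
  by rewrite set_coord_in set_coord_out// set_coord_in.
rewrite set_coord_out//; have [<-|ac] := eqVneq a c; first by rewrite !set_coord_in.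
by rewrite !set_coord_out.
Qed.

Lemma dfwith_id (T : 'I_l -> Type) (u : forall a, T a) a :
  dfwith u (u a) = u.
Proof.
by apply: functional_extensionality_dep => b; case: dfwithP.
Qed.

Lemma dfwith_map (T T' : 'I_l -> Type) (f : forall a, T a -> T' a)
    (u : forall a, T a) a (v : T a) :
  (fun b => f b (dfwith u v b)) = dfwith (fun b => f b (u b)) (f a v).
Proof.
apply: functional_extensionality_dep => b.
by case: dfwithP => [|c ac]; rewrite ?dfwith_in ?dfwith_out.
Qed.

End Update.

(** The tensor whose form is Gamma(u_1, ..., X u_a, ..., u_l). The transposed
indices make it a right action, see [mode_act_mul]. *)
Definition mode_act (R : comNzRingType) (l : nat) (d : 'I_l -> nat) (a : 'I_l)
    (X : 'M[R]_(d a)) (G : multi_index d -> R) : multi_index d -> R :=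
  fun i => \sum_j X j (i a) * G (set_coord i j).

(** The left-hand side of the derivation identity as a tensor, see
[form_lie_act]. Coefficients lie in any commutative ring because the
deformation argument takes place over polynomials. *)
Definition lie_act (R : comNzRingType) (l : nat) (d : 'I_l -> nat)
    (G : multi_index d -> R) (x : forall a, 'M[R]_(d a)) : multi_index d -> R :=
  fun i => \sum_(a < l) mode_act (x a) G i.

Section Derivations.
Variables (R : comNzRingType) (l : nat) (d : 'I_l -> nat).
Implicit Types (G : multi_index d -> R) (x y : forall a, 'M[R]_(d a)).

Lemma mode_act_comm a b (X : 'M[R]_(d a)) (Y : 'M[R]_(d b)) G i :
  a != b -> mode_act X (mode_act Y G) i = mode_act Y (mode_act X G) i.
Proof.
move=> ab; rewrite /mode_act.
under eq_bigr do rewrite big_distrr set_coord_out//=.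
under [in RHS]eq_bigr do rewrite big_distrr set_coord_out 1?eq_sym//=.
rewrite exchange_big /=; apply: eq_bigr => k _; apply: eq_bigr => j _.
by rewrite set_coord_comm// mulrCA.
Qed.

Lemma mode_act_mul a (X Y : 'M[R]_(d a)) G i :
  mode_act X (mode_act Y G) i = mode_act (Y *m X) G i.
Proof.
rewrite /mode_act; under eq_bigr do rewrite big_distrr /=.
rewrite exchange_big /=; apply: eq_bigr => k _.
rewrite mxE big_distrl /=; apply: eq_bigr => j _.
by rewrite set_coord_in set_coord_twice mulrCA mulrA.
Qed.

Lemma mode_act_sum a (X : 'M[R]_(d a)) (I : Type) (r : seq I)
    (F : I -> multi_index d -> R) i :
  mode_act X (fun i => \sum_(k <- r) F k i) i = \sum_(k <- r) mode_act X (F k) i.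
Proof.
by rewrite /mode_act exchange_big /=; apply: eq_bigr => j _; rewrite mulr_sumr.
Qed.

Lemma lie_act_comp G x y i :
  lie_act (lie_act G x) y i = \sum_b \sum_a mode_act (y b) (mode_act (x a) G) i.
Proof. by apply: eq_bigr => b _; rewrite mode_act_sum. Qed.

Lemma lie_actB G x y i :
  lie_act G (fun a => x a - y a) i = lie_act G x i - lie_act G y i.
Proof.
rewrite /lie_act -sumrB; apply: eq_bigr => a _; rewrite /mode_act -sumrB.
by apply: eq_bigr => j _; rewrite !mxE mulrBl.
Qed.

Lemma lie_actD G x y i :
  lie_act G (fun a => x a + y a) i = lie_act G x i + lie_act G y i.
Proof.
rewrite /lie_act -big_split; apply: eq_bigr => a _; rewrite /mode_act -big_split.
by apply: eq_bigr => j _; rewrite !mxE mulrDl.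
Qed.

Lemma lie_actZ G c x i : lie_act G (fun a => c *: x a) i = c * lie_act G x i.
Proof.
rewrite /lie_act mulr_sumr; apply: eq_bigr => a _; rewrite /mode_act mulr_sumr.
by apply: eq_bigr => j _; rewrite !mxE mulrA.
Qed.

Definition is_der G x := forall i, lie_act G x i = 0.

Lemma is_derB G x y :
  is_der G x -> is_der G y -> is_der G (fun a => x a - y a).
Proof. by move=> dx dy i; rewrite lie_actB dx dy subr0. Qed.

Lemma is_derD G x y :
  is_der G x -> is_der G y -> is_der G (fun a => x a + y a).
Proof. by move=> dx dy i; rewrite lie_actD dx dy addr0. Qed.

Lemma is_derZ G c x : is_der G x -> is_der G (fun a => c *: x a).
Proof. by move=> dx i; rewrite lie_actZ dx mulr0. Qed.

(** In the commutator of the actions of x and y, operators on different modes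
commute and cancel; the diagonal terms give the bracket. *)
Lemma is_der_bracket G x y :
  is_der G x -> is_der G y ->
  is_der G (fun a => x a *m y a - y a *m x a).
Proof.
move=> dx dy i.
have l0 z : lie_act (fun=> 0 : R) z i = 0.
  by rewrite /lie_act big1// => a _; rewrite /mode_act big1// => j _; rewrite mulr0.
have ex G' : (forall i, G' i = 0) -> forall z, lie_act G' z i = 0.
  move=> G0 z; rewrite -(l0 z); apply: eq_bigr => a _; apply: eq_bigr => j _.
  by rewrite G0.
have := ex _ dx y; have := ex _ dy x; rewrite !lie_act_comp => xy0 yx0.
transitivity (\sum_b \sum_a mode_act (y b) (mode_act (x a) G) i -
              \sum_b \sum_a mode_act (x a) (mode_act (y b) G) i); last first.
  by rewrite [X in _ - X]exchange_big /= xy0 yx0 subrr.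
rewrite -sumrB lie_actB /lie_act -sumrB; apply: eq_bigr => b _.
rewrite -!mode_act_mul -[RHS]sumrB [RHS](bigD1 b)//= big1 ?addr0// => a ab.
by rewrite mode_act_comm ?subrr// eq_sym.
Qed.

Lemma mode_act_diag a (t : 'rV[R]_(d a)) G i :
  mode_act (diag_mx t) G i = t 0 (i a) * G i.
Proof.
rewrite /mode_act (bigD1 (i a))//= big1 => [|j ji]; last first.
  by rewrite mxE (negPf ji) mul0r.
by rewrite addr0 mxE eqxx set_coord_id.
Qed.

Lemma lie_act_diag (t : forall a, 'rV[R]_(d a)) G i :
  lie_act G (fun a => diag_mx (t a)) i = (\sum_a t a 0 (i a)) * G i.
Proof.
by rewrite /lie_act mulr_suml; apply: eq_bigr => a _; rewrite mode_act_diag.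
Qed.

End Derivations.

Lemma lie_act_map (R S : comNzRingType) (f : {rmorphism R -> S}) (l : nat)
    (d : 'I_l -> nat) (G : multi_index d -> R) (x : forall a, 'M[R]_(d a)) i :
  lie_act (f \o G) (fun a => map_mx f (x a)) i = f (lie_act G x i).
Proof.
rewrite /lie_act rmorph_sum; apply: eq_bigr => a _; rewrite /mode_act rmorph_sum.
by apply: eq_bigr => j _; rewrite /= mxE rmorphM.
Qed.

Section Forms.
Variables (K : fieldType) (l : nat) (d : 'I_l -> nat).
Implicit Types (G : tensor K d) (u : forall a, 'cV[K]_(d a)).

Lemma prod_dfwith u a (v : 'cV[K]_(d a)) (i : multi_index d) :
  \prod_b dfwith u v b (i b) 0 =
  v (i a) 0 * \prod_(b | b != a) u b (i b) 0.
Proof.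
rewrite (bigD1 a)//= dfwith_in; congr (_ * _).
by apply: eq_bigr => b ba; rewrite dfwith_out// eq_sym.
Qed.

Lemma tensor_form_lin G u a (I : finType) (c : I -> K)
    (v : I -> 'cV[K]_(d a)) :
  tensor_form G (dfwith u (\sum_k c k *: v k)) =
  \sum_k c k * tensor_form G (dfwith u (v k)).
Proof.
rewrite /tensor_form; under [RHS]eq_bigr do rewrite mulr_sumr.
rewrite [RHS]exchange_big; apply: eq_bigr => i _.
rewrite prod_dfwith summxE mulr_suml mulr_sumr; apply: eq_bigr => k _.
by rewrite prod_dfwith mxE; ring.
Qed.

Lemma tensor_form_delta G (i : multi_index d) :
  tensor_form G (fun a => delta_mx (i a) 0) = G i.
Proof.
rewrite /tensor_form (bigD1 i)//= [X in _ + X]big1 => [|j ji].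
  by rewrite big1 ?mulr1 ?addr0// => a _; rewrite mxE !eqxx.
have [a ja] : exists a, j a != i a.
  apply/existsP; apply: contraT => /existsPn ij.
  by case/negP: ji; apply/eqP/ffunP => a; apply/eqP; apply: contraT => /(negP (ij a)).
by rewrite (bigD1 a)//= mxE (negPf ja) mul0r mulr0.
Qed.

Lemma cV_sum_delta n (v : 'cV[K]_n) : v = \sum_j v j 0 *: delta_mx j 0.
Proof.
rewrite [LHS]matrix_sum_delta; apply: eq_bigr => j _.
by rewrite big_ord1.
Qed.

(** Coordinates are replaced by their expansions on the standard basis one at
a time; k counts those not yet known to be basis vectors. *)
Lemma multilinear_ext (f g : (forall a, 'cV[K]_(d a)) -> K) :
  (forall u a (v : 'cV[K]_(d a)),
     f (dfwith u v) = \sum_j v j 0 * f (dfwith u (delta_mx j 0))) ->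
  (forall u a (v : 'cV[K]_(d a)),
     g (dfwith u v) = \sum_j v j 0 * g (dfwith u (delta_mx j 0))) ->
  (forall i : multi_index d, f (fun a => delta_mx (i a) 0) =
     g (fun a => delta_mx (i a) 0)) ->
  f =1 g.
Proof.
move=> flin glin fg.
suff main k u : (k <= l)%N ->
    (forall a : 'I_l, (k <= a)%N -> exists j, u a = delta_mx j 0) ->
    f u = g u.
  by move=> u; apply: (main l) => // a; rewrite leqNgt ltn_ord.
elim: k u => [|k IHk] u kl ud.
  have /fin_all_exists[j uj] : forall a, exists j, u a = delta_mx j 0.
    by move=> a; apply: ud.
  suff -> : u = fun a => delta_mx (([ffun a => j a] : multi_index d) a) 0 by exact: fg.
  by apply: functional_extensionality_dep => a; rewrite ffunE -uj.
pose a := Ordinal kl.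
rewrite -[u](dfwith_id u a) flin glin; apply: eq_bigr => j _; congr (_ * _).
apply: IHk => [|b kb]; first exact: ltnW.
move: kb; case: dfwithP => [|c ac kc]; first by exists j.
apply: ud; rewrite ltn_neqAle kc andbT.
by apply: contraNneq ac => ekc; apply/eqP/val_inj.
Qed.

Definition change_basis (G : tensor K d) (P : forall a, 'M[K]_(d a)) :
    tensor K d :=
  fun i => tensor_form G (fun a => col (i a) (P a)).

Lemma tensor_form_change_basis G (P : forall a, 'M[K]_(d a)) u :
  tensor_form (change_basis G P) u = tensor_form G (fun a => P a *m u a).
Proof.
move: u; apply: multilinear_ext => [u a v|u a v|i].
- by rewrite [in LHS](cV_sum_delta v) tensor_form_lin.
- rewrite (dfwith_map (fun a => mulmx (P a))) [in LHS](cV_sum_delta v) mulmx_sumr.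
  under eq_bigr do rewrite -scalemxAr.
  rewrite tensor_form_lin; apply: eq_bigr => j _.
  by rewrite (dfwith_map (fun a => mulmx (P a))).
- rewrite tensor_form_delta /change_basis; congr tensor_form.
  by apply: functional_extensionality_dep => a; rewrite colE.
Qed.

(** Exchanging the summation index j of D_a u_a with the coordinate i_a is an
involution of the pairs (i, j), which moves D_a from u_a to the coefficients.
*)
Lemma form_lie_act G (D : forall a, 'M[K]_(d a)) u :
  \sum_a tensor_form G (dfwith u (D a *m u a)) = tensor_form (lie_act G D) u.
Proof.
rewrite /tensor_form /lie_act; under [RHS]eq_bigr do rewrite mulr_suml.
rewrite [RHS]exchange_big /=; apply: eq_bigr => a _.
pose F (p : multi_index d * 'I_(d a)) := G p.1 * (D a (p.1 a) p.2 * u a p.2 0 *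
  \prod_(b | b != a) u b (p.1 b) 0).
transitivity (\sum_p F p).
  rewrite -(pair_bigA _ (fun i j => F (i, j))) /=; apply: eq_bigr => i _.
  by rewrite prod_dfwith mxE mulr_suml mulr_sumr.
pose h (p : multi_index d * 'I_(d a)) := (set_coord p.1 p.2, p.1 a).
have hK : involutive h.
  by move=> [i j]; rewrite /h /= set_coord_in set_coord_twice set_coord_id.
rewrite (reindex_inj (inv_inj hK)) -(pair_bigA _ (fun i j => F (h (i, j)))) /=.
apply: eq_bigr => i _; rewrite /mode_act mulr_suml; apply: eq_bigr => j _.
rewrite /F /h /= set_coord_in (bigD1 a (P := predT))//=.
under eq_bigr => b ba do rewrite set_coord_out 1?eq_sym//.
by ring.
Qed.

Lemma uni_derivationP G D : uni_derivation G D <-> is_der G D.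
Proof.
split=> dD.
  by move=> i; rewrite -[LHS](tensor_form_delta (lie_act G D)) -form_lie_act dD.
move=> u; rewrite form_lie_act /tensor_form big1// => i _.
by rewrite dD mul0r.
Qed.

Lemma uni_derivation_conj G (P D : forall a, 'M[K]_(d a)) :
  (forall a, P a \in unitmx) ->
  uni_derivation (change_basis G P) (fun a => invmx (P a) *m D a *m P a) <->
  uni_derivation G D.
Proof.
move=> Pu; have sumE u :
    \sum_a tensor_form (change_basis G P)
      (dfwith u (invmx (P a) *m D a *m P a *m u a)) =
    \sum_a tensor_form G
      (dfwith (fun b => P b *m u b) (D a *m (P a *m u a))).
  apply: eq_bigr => a _; rewrite tensor_form_change_basis.
  rewrite (dfwith_map (fun a => mulmx (P a))); congr (tensor_form _ (dfwith _ _)).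
  by rewrite !mulmxA mulmxV// mul1mx.
split=> dD u; last by rewrite sumE dD.
apply: etrans (dD (fun a => invmx (P a) *m u a)); rewrite sumE.
have -> : (fun b => P b *m (invmx (P b) *m u b)) = u.
  by apply: functional_extensionality_dep => b; rewrite mulKVmx.
by apply: eq_bigr => a _; rewrite mulKVmx.
Qed.

End Forms.

(** * Jordan parts of a derivation *)

Section JordanDerivation.
Variables (K : fieldType) (l : nat) (d : 'I_l -> nat) (G : tensor K d).
Implicit Types (u : forall a, 'cV[K]_(d a)).

Lemma tensor_formD u a (v w : 'cV[K]_(d a)) :
  tensor_form G (dfwith u (v + w)) =
  tensor_form G (dfwith u v) + tensor_form G (dfwith u w).
Proof.
rewrite /tensor_form -big_split; apply: eq_bigr => i _.
by rewrite !prod_dfwith mxE /=; ring.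
Qed.

Lemma tensor_formZ u a c (v : 'cV[K]_(d a)) :
  tensor_form G (dfwith u (c *: v)) = c * tensor_form G (dfwith u v).
Proof.
rewrite /tensor_form mulr_sumr; apply: eq_bigr => i _.
by rewrite !prod_dfwith mxE /=; ring.
Qed.

Lemma tensor_form_eq0 u a : u a = 0 -> tensor_form G u = 0.
Proof.
move=> ua; rewrite /tensor_form big1// => i _.
by rewrite (bigD1 a)//= ua mxE mul0r mulr0.
Qed.

(** Put w_k = (N_a^(k_a) u_a)_a, again eigenvectors of S with eigenvalues c_a.
Applied to w_k, the derivation identity reads (sum of c_a) * Gamma(w_k) = -
sum of the Gamma(w_k') with one exponent increased. These vanish once an
exponent is large, hence, if the c_a do not sum to 0, all of them do. *)
Lemma form_eigenvectors (S N : forall a, 'M[K]_(d a)) u (c : 'I_l -> K) :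
  uni_derivation G (fun a => S a + N a) ->
  (forall a, nilpotent_mx (N a)) -> (forall a, comm_mx (S a) (N a)) ->
  (forall a, S a *m u a = c a *: u a) ->
  (\sum_a c a) * tensor_form G u = 0.
Proof.
move=> dSN /fin_all_exists[m Nm] cSN Su.
have [->|c0] := eqVneq (\sum_a c a) 0; first by rewrite mul0r.
pose w k a := N a ^+ k a *m u a.
suff main n (k : 'I_l -> nat) :
    (\sum_a (m a - k a) < n)%N -> tensor_form G (w k) = 0.
  have wE : w (fun=> 0%N) = u.
    apply: functional_extensionality_dep => a.
    by rewrite /w expr0 mul1mx.
  by rewrite -wE (main _ _ (ltnSn _)) mulr0.
elim: n k => // n IHn k kn.
have [/existsP[a mk]|/existsPn mk] := boolP [exists a, m a <= k a]%N.
  apply: (tensor_form_eq0 (a := a)).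
  by rewrite /w -(subnKC mk) exprD Nm mul0r mul0mx.
have Sw a : S a *m w k a = c a *: w k a.
  rewrite /w mulmxA.
  have -> : S a *m N a ^+ k a = N a ^+ k a *m S a by apply: commrX; exact: cSN.
  by rewrite -mulmxA Su scalemxAr.
apply: (mulfI c0); rewrite mulr0 mulr_suml.
rewrite -[RHS](dSN (w k)); apply: eq_bigr => a _.
rewrite mulmxDl tensor_formD Sw tensor_formZ dfwith_id.
rewrite [X in _ = _ + X](_ : _ = 0) ?addr0//.
pose k' : 'I_l -> nat := @dfwith _ (fun=> nat) k a (k a).+1.
rewrite -[RHS](IHn k'); last first.
  rewrite -ltnS; apply: leq_trans kn; rewrite ltnS.
  rewrite (bigD1 a)//= [X in (_ < X)%N](bigD1 a)//=.
  rewrite /k' dfwith_in (eq_bigr (fun b => m b - k b)%N); last first.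
    by move=> b ba; rewrite dfwith_out// eq_sym.
  by rewrite ltn_add2r; have := mk a; lia.
congr tensor_form; apply: functional_extensionality_dep => b.
rewrite /w /k'; case: dfwithP => [|b' ab]; last by rewrite dfwith_out.
by rewrite dfwith_in exprS -mulmxE mulmxA.
Qed.

Lemma uni_derivation_jordan (D S N : forall a, 'M[K]_(d a)) :
  uni_derivation G D -> (forall a, jordan_chevalley (D a) (S a) (N a)) ->
  uni_derivation G S /\ uni_derivation G N.
Proof.
move=> dD jc.
have DE : D = fun a => S a + N a.
  by apply: functional_extensionality_dep => a; case: (jc a).
suff dS : uni_derivation G S.
  split=> //; apply/uni_derivationP => i.
  have -> : N = fun a => D a - S a.
    by rewrite DE; apply: functional_extensionality_dep => a; rewrite addrC addKr.
  by apply: is_derB; apply/uni_derivationP.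
have /fin_all_exists[P /all_and2[Pu]] : forall a, exists P, P \in unitmx /\
    exists t : 'rV[K]_(d a), S a = invmx P *m diag_mx t *m P.
  by move=> a; apply/diagonalizable_ex; case: (jc a).
move=> /fin_all_exists[t St].
have Pu' a : invmx (P a) \in unitmx by rewrite unitmx_inv.
apply/(uni_derivation_conj G S Pu')/uni_derivationP => i.
have -> : (fun a => invmx (invmx (P a)) *m S a *m invmx (P a)) =
          fun a => diag_mx (t a).
  apply: functional_extensionality_dep => a.
  by rewrite St invmxK !mulmxA mulmxV// mul1mx mulmxK.
rewrite lie_act_diag; apply: (form_eigenvectors (S := S) (N := N)).
- by rewrite -DE.
- by move=> a; case: (jc a).
- by move=> a; case: (jc a).
move=> a; rewrite {1}St -!mulmxA colE mulKVmx// -colE.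
rewrite colE scalemxAr; congr (_ *m _); apply/matrixP => r q.
rewrite mul_diag_mx !mxE; case: eqP => [->//|_].
by rewrite !mulr0.
Qed.

End JordanDerivation.

(** * Congruences of matrices over polynomials, and exponentials *)

(** The identity exp(v) a_0 = (sum of a_i) exp(v), where a_i = ad(v)^i(a_0) /
i!, truncated at total degree below N. The sequences are given by their
recurrences, so that division by factorials is replaced by the torsion
hypothesis. *)
Lemma exp_ad_conv (A : pzRingType) (v : A) (e a : nat -> A) :
  (forall n (y : A), y *+ n.+1 = 0 -> y = 0) ->
  e 0%N = 1 -> (forall j, e j.+1 *+ j.+1 = v * e j) ->
  (forall i, a i.+1 *+ i.+1 = v * a i - a i * v) ->
  forall N, \sum_(i < N) a i * (\sum_(j < N - i) e j) =
            (\sum_(j < N) e j) * a 0%N.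
Proof.
move=> tf e0 eS aS.
have conv n : e n * a 0%N = \sum_(i < n.+1) a i * e (n - i)%N.
  elim: n => [|n IHn]; first by rewrite big_ord1 e0 mul1r mulr1.
  apply/eqP; rewrite -subr_eq0; apply/eqP/(tf n); rewrite mulrnBl.
  rewrite -mulrnAl eS -mulrA IHn mulr_sumr -sumrMnl.
  have -> : \sum_(i < n.+2) a i * e (n.+1 - i)%N *+ n.+1 =
      \sum_(i < n.+2) (a i *+ i) * e (n.+1 - i)%N +
      \sum_(i < n.+2) a i * (e (n.+1 - i)%N *+ (n.+1 - i)).
    rewrite -big_split; apply: eq_bigr => i _ /=.
    by rewrite mulrnAl mulrnAr -mulrnDr subnKC// -ltnS ltn_ord.
  rewrite [X in _ - (X + _)]big_ord_recl /= mulr0n mul0r add0r.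
  rewrite [X in _ - (_ + X)]big_ord_recr /= subnn mulr0n mulr0.
  rewrite addr0 -big_split -sumrB big1// => i _ /=.
  rewrite /bump /= add1n subSS aS subSn -1?ltnS// eS mulrBl mulrA.
  by rewrite -!mulrA subrK subrr.
elim=> [|N IHN]; first by rewrite !big_ord0 mul0r.
rewrite [in RHS]big_ord_recr mulrDl /= -IHN conv big_ord_recr /=.
rewrite [in RHS]big_ord_recr /= subnn subSn// subnn big_ord1 addrA.
congr (_ + _); rewrite -big_split; apply: eq_bigr => i _ /=.
by rewrite subSn ?big_ord_recr ?mulrDr// ltnW.
Qed.

Section Xdvd.
Variable K : fieldType.

Definition xdvd (m n k : nat) (A : 'M[{poly K}]_(m, n)) : Prop :=
  exists Z, A = 'X^k *: Z.

Lemma xdvdP m n k (A : 'M[{poly K}]_(m, n)) :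
  xdvd k A <-> forall i j, 'X^k %| A i j.
Proof.
split=> [[Z ->] i j|XA]; first by rewrite mxE dvdp_mulr.
exists (\matrix_(i, j) (A i j %/ 'X^k)); apply/matrixP => i j.
by rewrite !mxE mulrC divpK.
Qed.

Lemma xdvdD m n k (A B : 'M[{poly K}]_(m, n)) :
  xdvd k A -> xdvd k B -> xdvd k (A + B).
Proof. by move=> [Z ->] [Y ->]; exists (Z + Y); rewrite scalerDr. Qed.

Lemma xdvdN m n k (A : 'M[{poly K}]_(m, n)) : xdvd k A -> xdvd k (- A).
Proof. by move=> [Z ->]; exists (- Z); rewrite scalerN. Qed.

Lemma xdvdB m n k (A B : 'M[{poly K}]_(m, n)) :
  xdvd k A -> xdvd k B -> xdvd k (A - B).
Proof. by move=> dA dB; apply/xdvdD/xdvdN. Qed.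

Lemma xdvdZ m n k c (A : 'M[{poly K}]_(m, n)) : xdvd k A -> xdvd k (c *: A).
Proof. by move=> [Z ->]; exists (c *: Z); rewrite !scalerA mulrC. Qed.

Lemma xdvdM m n p k k' (A : 'M[{poly K}]_(m, n)) (B : 'M[{poly K}]_(n, p)) :
  xdvd k A -> xdvd k' B -> xdvd (k + k') (A *m B).
Proof.
move=> [Z ->] [Y ->]; exists (Z *m Y).
by rewrite -scalemxAl -scalemxAr scalerA exprD.
Qed.

Lemma xdvd_le m n k k' (A : 'M[{poly K}]_(m, n)) :
  (k' <= k)%N -> xdvd k A -> xdvd k' A.
Proof.
move=> kk [Z ->]; exists ('X^(k - k') *: Z).
by rewrite scalerA -exprD subnKC.
Qed.

Lemma xdvd0 m n (A : 'M[{poly K}]_(m, n)) : xdvd 0 A.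
Proof. by exists A; rewrite expr0 scale1r. Qed.

Lemma xdvd_sum m n k (I : Type) (r : seq I) (P : pred I)
    (F : I -> 'M[{poly K}]_(m, n)) :
  (forall i, P i -> xdvd k (F i)) -> xdvd k (\sum_(i <- r | P i) F i).
Proof.
move=> dF; elim/big_rec: _ => [|i A Pi dA]; last by apply: xdvdD => //; apply: dF.
by exists 0; rewrite scaler0.
Qed.

End Xdvd.

Section EqMod.
Variables (R : comNzRingType) (p : R).

Definition eqmod (x y : R) : Prop := exists q, x = y + p * q.

Lemma eqmod_refl x : eqmod x x.
Proof. by exists 0; rewrite mulr0 addr0. Qed.

Lemma eqmodD x y x' y' : eqmod x y -> eqmod x' y' -> eqmod (x + x') (y + y').
Proof. by move=> [q ->] [q' ->]; exists (q + q'); ring. Qed.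

Lemma eqmodM x y x' y' : eqmod x y -> eqmod x' y' -> eqmod (x * x') (y * y').
Proof.
by move=> [q ->] [q' ->]; exists (q * y' + y * q' + p * q * q'); ring.
Qed.

Lemma eqmod_sum (I : Type) (r : seq I) (P : pred I) (F F' : I -> R) :
  (forall i, P i -> eqmod (F i) (F' i)) ->
  eqmod (\sum_(i <- r | P i) F i) (\sum_(i <- r | P i) F' i).
Proof.
by move=> FF'; apply: big_ind2 => //; [apply: eqmod_refl|apply: eqmodD].
Qed.

Lemma eqmod_prod (I : Type) (r : seq I) (P : pred I) (F F' : I -> R) :
  (forall i, P i -> eqmod (F i) (F' i)) ->
  eqmod (\prod_(i <- r | P i) F i) (\prod_(i <- r | P i) F' i).
Proof.
by move=> FF'; apply: big_ind2 => //; [apply: eqmod_refl|apply: eqmodM].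
Qed.

Lemma eqmodX x y k : eqmod x y -> eqmod (x ^+ k) (y ^+ k).
Proof.
move=> xy; elim: k => [|k IHk]; first exact: eqmod_refl.
by rewrite !exprS; apply: eqmodM.
Qed.

Lemma eqmod_sym x y : eqmod x y -> eqmod y x.
Proof. by move=> [q ->]; exists (- q); ring. Qed.

Lemma eqmod_meval n (P : {mpoly R[n]}) (v w : 'I_n -> R) :
  (forall i, eqmod (v i) (w i)) -> eqmod P.@[v] P.@[w].
Proof.
move=> vw; rewrite !mevalE; apply: eqmod_sum => m _.
apply: eqmodM; first exact: eqmod_refl.
by apply: eqmod_prod => i _; apply: eqmodX.
Qed.

End EqMod.

Lemma det_eqmod (R : comNzRingType) n (p : R) (B Z : 'M[R]_n) :
  eqmod p (\det (B + p *: Z)) (\det B).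
Proof.
apply: eqmod_sum => s _; apply: eqmodM; first exact: eqmod_refl.
by apply: eqmod_prod => i _; rewrite !mxE; exists (Z i (s i)).
Qed.

Definition char_poly_eqmod (K : fieldType) (n N : nat) (x y : 'M[{poly K}]_n) :=
  forall m, 'X^N %| (char_poly x)`_m - (char_poly y)`_m.

Lemma char_poly_eqmod_xdvd (K : fieldType) (n N : nat) (x y : 'M[{poly K}]_n) :
  xdvd N (x - y) -> char_poly_eqmod N x y.
Proof.
move=> [Z xy] m.
have -> : x = y + 'X^N *: Z by rewrite -xy addrC subrK.
rewrite /char_poly.
have -> : char_poly_mx (y + 'X^N *: Z) =
    char_poly_mx y + ('X^N)%:P *: - map_mx polyC Z.
  rewrite /char_poly_mx map_mxD /=  opprD addrA; congr (_ + _).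
  by apply/matrixP => i j; rewrite !mxE polyCM mulrN.
have [q ->] := det_eqmod ('X^N)%:P (char_poly_mx y) (- map_mx polyC Z).
by rewrite coefD addrC addKr coefCM dvdp_mulr.
Qed.

(** Writing y e = e x modulo 'X^N, one gets det(e) * char_poly y = det(e) *
char_poly x modulo 'X^N, and det(e), which is 1 modulo 'X, is prime to 'X^N.
*)
Lemma char_poly_eqmod_conj (K : fieldType) (n N : nat) (e x y : 'M[{poly K}]_n) :
  xdvd 1 (e - 1%:M) -> xdvd N (e *m x - y *m e) -> char_poly_eqmod N x y.
Proof.
move=> [E eE] [Z exy] m.
have det_e : exists q, \det e = 1 + 'X * q.
  have -> : e = 1%:M + 'X *: E by rewrite -[X in X *: E]expr1 -eE addrC subrK.
  by have [q ->] := det_eqmod 'X (1%:M) E; exists q; rewrite det1.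
have cop : coprimep 'X^N (\det e).
  apply: coprimep_expl; rewrite coprimep_sym coprimepX.
  have [q ->] := det_e.
  by rewrite /root hornerD hornerM hornerX hornerC mul0r addr0 oner_eq0.
have : exists q, char_poly y * (\det e)%:P =
    (\det e)%:P * char_poly x + ('X^N)%:P * q.
  rewrite -det_map_mx -!det_mulmx.
  have -> : char_poly_mx y *m map_mx polyC e =
      map_mx polyC e *m char_poly_mx x + ('X^N)%:P *: map_mx polyC Z.
    rewrite /char_poly_mx mulmxBl mulmxBr -scalar_mxC -!map_mxM.
    have -> : y *m e = e *m x - 'X^N *: Z by rewrite -exy opprB addrC subrK.
    by rewrite map_mxB map_mxZ opprB [in RHS]addrAC -addrA.
  by apply: det_eqmod.
move=> [q /(congr1 (fun p : {poly {poly K}} => p`_m))].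
rewrite coefD coefMC !coefCM => yx.
rewrite -(Gauss_dvdpr _ cop) mulrBr [X in _ - X]mulrC yx.
by rewrite opprD addrA subrr add0r dvdpNr dvdp_mulr.
Qed.

Lemma char_poly_eqmod_trans (K : fieldType) (n N : nat) (x y z : 'M[{poly K}]_n) :
  char_poly_eqmod N x y -> char_poly_eqmod N y z -> char_poly_eqmod N x z.
Proof.
move=> xy yz m; have := dvdp_add (xy m) (yz m).
by rewrite addrA subrK.
Qed.

Lemma char_poly_eqmod_le (K : fieldType) (n N M : nat) (x y : 'M[{poly K}]_n) :
  (N <= M)%N -> char_poly_eqmod M x y -> char_poly_eqmod N x y.
Proof. by move=> NM xy m; apply: dvdp_trans (xy m); apply: dvdp_exp2l. Qed.

(** The matrix ad(v)^i(x) / i!. *)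
Fixpoint ad_div (K : numFieldType) (n : nat) (v x : 'M[{poly K}]_n) (i : nat) :=
  if i is i'.+1 then
    (i%:R^-1)%:P *: (v *m ad_div v x i' - ad_div v x i' *m v)
  else x.

(** The matrix v^i / i!. *)
Fixpoint exp_div (K : numFieldType) (n : nat) (v : 'M[{poly K}]_n) (i : nat) :=
  if i is i'.+1 then (i%:R^-1)%:P *: (v *m exp_div v i') else 1%:M.

Section Exponential.
Variables (K : numFieldType) (n : nat).
Implicit Types (v x : 'M[{poly K}]_n).

Lemma divrnK (V : lmodType {poly K}) i (y : V) :
  ((i.+1%:R : K)^-1)%:P *: y *+ i.+1 = y.
Proof.
rewrite -scaler_nat scalerA -polyC_natr -polyCM mulfV ?pnatr_eq0//.
by rewrite scale1r.
Qed.

Lemma xdvd_exp_div v k i : xdvd k v -> xdvd (k * i) (exp_div v i).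
Proof.
move=> dv; elim: i => [|i IHi] /=; first by rewrite muln0; apply: xdvd0.
by apply: xdvdZ; rewrite mulnS; apply: xdvdM.
Qed.

Lemma xdvd_ad_div v x k i : xdvd k v -> xdvd (k * i) (ad_div v x i).
Proof.
move=> dv; elim: i => [|i IHi] /=; first by rewrite muln0; apply: xdvd0.
apply: xdvdZ; apply: xdvdB; first by rewrite mulnS; apply: xdvdM.
by rewrite mulnSr; apply: xdvdM.
Qed.

(** The truncated sum is exp(v) x exp(-v) modulo 'X^N, since v is divisible by
'X. *)
Lemma char_poly_eqmod_exp v x N :
  xdvd 1 v -> (0 < N)%N -> char_poly_eqmod N x (\sum_(i < N) ad_div v x i).
Proof.
move=> dv N0; pose e := \sum_(i < N) exp_div v i.
apply: (char_poly_eqmod_conj (e := e)).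
  rewrite /e -(prednK N0) big_ord_recl -[exp_div v _]/(1%:M) addrC addKr.
  by apply: xdvd_sum => i _; apply: xdvd_le _ (xdvd_exp_div _ dv).
have : \sum_(i < N) ad_div v x i *m (\sum_(j < N - i) exp_div v j) = e *m x.
  rewrite /e -[x in RHS]/(ad_div v x 0).
  apply: (@exp_ad_conv _ v (exp_div v) (ad_div v x)) => //.
  - by move=> k y /(congr1 (fun z => (k.+1%:R^-1)%:P *: z)); 
      rewrite -scalerMnr divrnK scaler0.
  - by move=> j; apply: divrnK.
  - by move=> i; apply: divrnK.
move=> <-; rewrite mulmx_suml -sumrB; apply: xdvd_sum => i _.
rewrite -mulmxBr.
have iN : (N <= 1 * i + (N - i))%N by rewrite mul1n -leq_subLR.
apply: xdvd_le iN _; apply: xdvdM; first exact: xdvd_ad_div.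
have -> : e =
    \sum_(j < N - i) exp_div v j + \sum_(N - i <= j < N) exp_div v j.
  by rewrite /e -!(big_mkord predT (exp_div v)) -big_cat_nat ?leq_subr.
rewrite opprD addrA subrr add0r big_nat; apply/xdvdN/xdvd_sum => j /andP[ij _].
by apply: xdvd_le _ (xdvd_exp_div _ dv); rewrite mul1n.
Qed.

End Exponential.

(** * Deformation into the centralizer of a diagonal derivation *)

Section Weights.
Variables (K : numFieldType) (l : nat) (d : 'I_l -> nat) (G : tensor K d).
Variable (t : forall a, 'rV[K]_(d a)).
Hypothesis dert : is_der G (fun a => diag_mx (t a)).
Implicit Types (x y : forall a, 'M[{poly K}]_(d a)).

Let Gp : multi_index d -> {poly K} := polyC \o G.
Let T a : 'M[{poly K}]_(d a) := map_mx polyC (diag_mx (t a)).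

(** Gamma is supported on the multi-indices i on which the t_(i_a) sum to 0.
In the coordinate i of the derivation identity for x, the entry x_a(j, i_a) is
multiplied by Gamma(i with i_a := j); if this is not 0, then t_(i_a) - t_j is
the sum of all t_(i_b), whatever a and j. So each coordinate involves entries
of a single weight, and rescaling the entries according to their weight
preserves derivations. *)
Lemma is_der_weight (f : K -> K) x : is_der Gp x ->
  is_der Gp (fun a => \matrix_(j, i)
    ((f (t a 0 i - t a 0 j))%:P * x a j i)).
Proof.
move=> dx i; transitivity ((f (\sum_a t a 0 (i a)))%:P * lie_act Gp x i); last first.
  by rewrite dx mulr0.
rewrite /lie_act mulr_sumr; apply: eq_bigr => a _; rewrite /mode_act mulr_sumr.
apply: eq_bigr => j _; rewrite mxE mulrA /Gp /=.
have [->|Gj] := eqVneq (G (set_coord i j)) 0; first by rewrite !mulr0.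
suff -> : t a 0 (i a) - t a 0 j = \sum_a t a 0 (i a) by [].
have := dert (set_coord i j); rewrite lie_act_diag => /eqP.
rewrite mulf_eq0 (negPf Gj) orbF => /eqP s0.
transitivity (t a 0 (i a) - t a 0 j + \sum_b t b 0 (set_coord i j b)).
  by rewrite s0 addr0.
rewrite (bigD1 a)//= [RHS](bigD1 a)//= set_coord_in addrA subrK.
by congr (_ + _); apply: eq_bigr => b ba; rewrite set_coord_out// eq_sym.
Qed.

Lemma is_der_const (x : forall a, 'M[K]_(d a)) :
  is_der G x -> is_der Gp (fun a => map_mx polyC (x a)).
Proof. by move=> dx i; rewrite lie_act_map dx rmorph0. Qed.

(** Congruent to diag(t) modulo 'X, and in its centralizer modulo 'X^k. *)
Definition near_centralizer (k : nat) x :=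
  [/\ is_der Gp x, forall a, xdvd 1 (x a - T a) &
      forall a i j, t a 0 i != t a 0 j -> 'X^k %| x a i j].

(** Conjugation by exp(v), where [v, diag(t)] is minus the part of x outside
the centralizer. Then v is divisible by 'X^k, and [v, x] = [v, diag(t)] modulo
'X^(k+1), so that this part is cancelled to first order. *)
Lemma near_centralizer_step N k x : (0 < k)%N -> near_centralizer k x ->
  exists y, near_centralizer k.+1 y /\ forall a, char_poly_eqmod N (x a) (y a).
Proof.
move=> k0 [dx x1 xk].
pose v a : 'M[{poly K}]_(d a) :=
  \matrix_(j, i) ((- (t a 0 i - t a 0 j)^-1)%:P * x a j i).
have dv : is_der Gp v by apply: (is_der_weight (fun c => - c^-1) dx).
have vk a : xdvd k (v a).
  apply/xdvdP => j i; rewrite mxE.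
  have [->|tij] := eqVneq (t a 0 i) (t a 0 j).
    by rewrite subrr invr0 oppr0 mul0r dvdp0.
  by rewrite dvdp_mull// xk// eq_sym.
have dad i : is_der Gp (fun a => ad_div (v a) (x a) i).
  elim: i => [|i IHi] //=; apply: is_derZ.
  exact: (is_der_bracket dv IHi).
have dsum M : is_der Gp (fun a => \sum_(i < M) ad_div (v a) (x a) i).
  elim: M => [|M IHM] i.
    rewrite /lie_act big1// => a _; rewrite /mode_act big1// => j _.
    by rewrite big_ord0 mxE mul0r.
  rewrite -[RHS](is_derD IHM (dad M) i); apply: eq_bigr => a _.
  by apply: eq_bigr => j _; rewrite big_ord_recr.
(* At least two terms are kept, so that the first-order one can be isolated. *)
pose y a := \sum_(i < N.+2) ad_div (v a) (x a) i.
pose c a := v a *m T a - T a *m v a.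
have yE a : xdvd k.+1 (y a - x a - c a).
  pose w := v a *m (x a - T a) - (x a - T a) *m v a.
  have -> : y a - x a - c a = w + \sum_(i < N) ad_div (v a) (x a) i.+2.
    rewrite /y 2!big_ord_recl /= [x a + _]addrC addrK invr1 scale1r.
    rewrite addrAC; congr (_ + _); rewrite /w /c mulmxBl mulmxBr !opprB.
    by rewrite addrACA [RHS]addrACA [_ - v a *m T a]addrC.
  apply: xdvdD; last first.
    apply: xdvd_sum => i _; apply: xdvd_le _ (xdvd_ad_div _ _ (vk a)).
    by rewrite mulnC; lia.
  rewrite /w -addn1; apply: xdvdB; first by apply: xdvdM.
  by rewrite addnC; apply: xdvdM.
exists y; split; last first.
  move=> a; apply: (@char_poly_eqmod_le _ _ N N.+2); first by rewrite -addn2 leq_addr.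
  by apply: char_poly_eqmod_exp; [apply: xdvd_le k0 (vk a)|].
have cE a j i : c a j i = - (t a 0 i != t a 0 j)%:R * x a j i.
  rewrite /c /T map_diag_mx mul_mx_diag mul_diag_mx !mxE.
  rewrite mulrC -mulrBl -polyCB mulrA -polyCM mulrN.
  have [->|tij] := eqVneq (t a 0 i) (t a 0 j); first by rewrite subrr mul0r !oppr0.
  by rewrite mulfV ?subr_eq0// polyCN.
split.
- exact: (dsum N.+2).
- move=> a; have -> : y a - T a = (y a - x a - c a) + ((x a - T a) + c a).
    by rewrite [x a - T a + c a]addrC addrA subrK addrA subrK.
  apply: xdvdD; first exact: xdvd_le (yE a).
  apply: xdvdD => //; apply: xdvd_le k0 _.
  rewrite -[k]addn0; apply: xdvdB; first exact: xdvdM (xdvd0 _).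
  by rewrite addnC; apply: xdvdM (xdvd0 _) _.
- move=> a i j tij; have /xdvdP/(_ i j) := yE a.
  have subE (A B : 'M[{poly K}]_(d a)) : (A - B) i j = A i j - B i j.
    by rewrite !mxE.
  by rewrite (subE (y a - x a)) (subE (y a)) cE eq_sym tij mulN1r opprK subrK.
Qed.

Lemma is_der_centralizer (x : forall a, 'M[{poly K}]_(d a)) : is_der Gp x ->
  is_der Gp (fun a => \matrix_(j, i) ((t a 0 i == t a 0 j)%:R * x a j i)).
Proof.
move=> dx i; rewrite -(is_der_weight (fun c => (c == 0)%:R) dx i).
apply: eq_bigr => a _; apply: eq_bigr => j _.
by rewrite !mxE subr_eq0 polyC_natr.
Qed.

(** After N + 1 steps the entries outside the centralizer are divisible by
'X^N; deleting them keeps a derivation, by [is_der_weight]. *)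
Lemma centralizer_normal_form N (E : forall a, 'M[K]_(d a)) : is_der G E ->
  exists z : forall a, 'M[{poly K}]_(d a),
    [/\ is_der Gp z,
        forall a i j, t a 0 i != t a 0 j -> z a i j = 0 &
        forall a, char_poly_eqmod N
          (T a + 'X *: (map_mx polyC (E a) - T a)) (z a)].
Proof.
move=> dE; pose x0 a := T a + 'X *: (map_mx polyC (E a) - T a).
have [x [nx cx]] : exists x, near_centralizer N.+1 x /\
    forall a, char_poly_eqmod N (x0 a) (x a).
  elim: {1}N => [|k [x [nx cx]]].
    exists x0; split; last by move=> a; apply: char_poly_eqmod_xdvd; rewrite subrr;
      exists 0; rewrite scaler0.
    split.
    - apply: is_derD; first exact: is_der_const.
      by apply/is_derZ/is_derB; apply: is_der_const.
    - move=> a; exists (map_mx polyC (E a) - T a).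
      by rewrite /x0 addrC addKr.
    - move=> a i j tij; rewrite !mxE (_ : (i == j) = false).
        by rewrite mulr0n polyC0 add0r expr1 dvdp_mulr.
      by apply: contraNF tij => /eqP ->.
  have [y [ny xy]] := near_centralizer_step N (ltn0Sn k) nx.
  exists y; split; first exact: ny.
  by move=> a; apply: char_poly_eqmod_trans (cx a) (xy a).
have [dx x1 xoff] := nx.
exists (fun a => \matrix_(j, i) ((t a 0 i == t a 0 j)%:R * x a j i)); split.
- exact: is_der_centralizer.
- by move=> a i j tij; rewrite mxE eq_sym (negPf tij) mul0r.
move=> a; apply: char_poly_eqmod_trans (cx a) _; apply: char_poly_eqmod_xdvd.
apply/xdvdP => i j; rewrite !mxE eq_sym.
have [|tij] := eqVneq; first by rewrite mul1r subrr dvdp0.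
by rewrite mul0r subr0; apply: dvdp_trans (xoff a i j tij); apply: dvdp_exp2l.
Qed.

End Weights.

(** * Specialization of relations between roots *)

Lemma meval_msym (R : comNzRingType) n (P : {mpoly R[n]}) (s : 'S_n) v :
  (msym s P).@[v] = P.@[v \o s].
Proof.
elim/mpolyind: P => [|c m P _ _ IHP]; first by rewrite msym0 !meval0.
rewrite msymD msymZ !mevalD !mevalZ IHP msymX !mevalX; congr (_ * _ + _).
rewrite (reindex_inj (@perm_inj _ s)) /=; apply: eq_bigr => i _.
by rewrite mnmE permK.
Qed.

Lemma meval_map_mpoly (R S : comNzRingType) (f : {rmorphism R -> S}) n
    (P : {mpoly R[n]}) v :
  (map_mpoly f P).@[f \o v] = f P.@[v].
Proof.
elim/mpolyind: P => [|c m P _ _ IHP]; first by rewrite rmorph0 !meval0 rmorph0.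
rewrite rmorphD /= map_mpolyZ map_mpolyX !mevalD !mevalZ IHP !mevalX.
rewrite rmorphD rmorphM rmorph_prod; congr (_ * _ + _).
by apply: eq_bigr => i _; rewrite rmorphXn.
Qed.

(** The elementary symmetric function of degree k + 1 of the roots of a monic
p of degree n, read off its coefficients. *)
Definition esym_coef (R : comNzRingType) (n : nat) (p : {poly R}) (k : 'I_n) : R :=
  (-1) ^+ k.+1 * p`_(n - k.+1).

Lemma mesym_roots (R : idomainType) (n : nat) (w : 'I_n -> R) (k : 'I_n) :
  (mesym n R k.+1).@[w] = esym_coef (\prod_i ('X - (w i)%:P)) k.
Proof.
have := mroots_coeff [tuple w i | i < n] (lift ord0 k).
rewrite /esym_coef big_tuple /= /bump leq0n add1n.
under eq_bigr do rewrite tnth_mktuple.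
move=> ->; rewrite mulrA -exprD addnn -muln2 exprM sqrr_sign mul1r.
by apply: meval_eq => i; rewrite tnth_mktuple.
Qed.

(** The relations C in Cs are combined into a single polynomial Q, with the
powers of a second indeterminate as coefficients. The product of Q over all
permutations of the variables is symmetric, so its value at the roots of p is
a polynomial r in the coefficients of p. Modulo 'X^N, r is the product of the
values of Q at the permutations of an approximate solution w, one factor of
which is 0; thus r = 0. Modulo 'X - c it is the product of the values at the
permutations of lam, and so one of these vanishes at c. *)
Lemma specialize_root_relations (F : fieldType) (n : nat) (p : {poly {poly F}})
    (Cs : seq {mpoly {poly F}[n]}) (lam : 'I_n -> F) (c : F) :
  (forall N, exists w : 'I_n -> {poly F},
     (forall m, 'X^N %| p`_m - (\prod_i ('X - (w i)%:P))`_m) /\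
     {in Cs, forall C, 'X^N %| C.@[w]}) ->
  map_poly (horner_eval c) p = \prod_i ('X - (lam i)%:P) ->
  exists s : 'S_n, {in Cs, forall C, (C.@[fun i => (lam (s i))%:P]).[c] = 0}.
Proof.
move=> approx pc.
pose A := {poly {poly F}}.
pose Q : {mpoly A[n]} :=
  \sum_(k < size Cs) 'X^k *: map_mpoly polyC Cs`_k.
have QE (v : 'I_n -> {poly F}) :
    Q.@[polyC \o v] = \sum_(k < size Cs) 'X^k * ((Cs`_k).@[v])%:P.
  rewrite raddf_sum; apply: eq_bigr => k _.
  by rewrite /= mevalZ (meval_map_mpoly polyC).
pose S := \prod_(s : 'S_n) msym s Q.
have symS : S \is symmetric.
  apply/issymP => s; rewrite rmorph_prod /= [RHS](reindex_inj (mulIg s)) /=.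
  by apply: eq_bigr => s' _; rewrite msymMm.
have [t [tS _]] := sym_fundamental symS.
have SE (v : 'I_n -> A) : \prod_(s : 'S_n) Q.@[v \o s] =
   t.@[fun k => (mesym n A k.+1).@[v]].
  have := congr1 (meval v) tS; rewrite comp_mpoly_meval rmorph_prod /=.
  under [X in _ = X -> _]eq_bigr do rewrite meval_msym.
  by move=> <-; apply: meval_eq => k; rewrite tnth_mktuple.
pose r : A := t.@[fun k => (esym_coef p k)%:P].
have rE (q : {poly F}) (w : 'I_n -> {poly F}) :
    (forall m, q %| p`_m - (\prod_i ('X - (w i)%:P))`_m) ->
    eqmod q%:P r (\prod_(s : 'S_n) Q.@[polyC \o (w \o s)]).
  move=> pw; rewrite (SE (polyC \o w)); apply: eqmod_meval => k.
  rewrite (mesym_roots (R := A)) /=.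
  have -> : \prod_i ('X - ((w i)%:P)%:P) =
      map_poly polyC (\prod_i ('X - (w i)%:P)) :> {poly A}.
    rewrite rmorph_prod; apply: eq_bigr => i _.
    by rewrite rmorphB /= map_polyX map_polyC.
  rewrite /esym_coef coef_map /=.
  have /dvdpP[z /eqP] := pw (n - k.+1)%N; rewrite subr_eq => /eqP ->.
  exists ((-1) ^+ k.+1 * z)%:P.
  have -> : (-1) ^+ k.+1 = ((-1) ^+ k.+1)%:P :> A by rewrite rmorphXn rmorphN1.
  by rewrite -!polyCM -polyCD; congr polyC; ring.
(* If r were not 0, its leading coefficient L would be divisible by
   'X^(size L). *)
have r0 : r = 0.
  apply/eqP; rewrite -lead_coef_eq0; set L := lead_coef r.
  apply: contraT => L0; have [w [pw Cw]] := approx (size L).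
  have [z] := rE _ _ pw; rewrite (bigD1 (1%g : 'S_n))//= => rz.
  have [q Qq] : exists q, Q.@[polyC \o (w \o (1%g : 'S_n))] = ('X^(size L))%:P * q.
    have -> : w \o (1%g : 'S_n) = w.
      by apply: functional_extensionality_dep => i; rewrite /= perm1.
    rewrite QE; elim/big_ind: _ => [|x y [x' ->] [y' ->]|k _].
    - by exists 0; rewrite mulr0.
    - by exists (x' + y'); rewrite mulrDr.
    - have /dvdpP[y ->] := Cw _ (mem_nth 0 (ltn_ord k)).
      by exists ('X^k * y%:P); rewrite polyCM mulrA mulrC.
  have /dvdp_leq : 'X^(size L) %| L.
    have [y ry] : exists y, r = ('X^(size L))%:P * y.
      by rewrite rz Qq -mulrA -mulrDr; eexists.
    suff rm m : 'X^(size L) %| r`_m by apply: rm.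
    by rewrite ry coefCM dvdp_mulr.
  by move=> /(_ L0); rewrite size_polyXn ltnn.
(* The constants lam i are the roots of p modulo 'X - c. *)
have := rE ('X - c%:P) (polyC \o lam) _; rewrite r0 => -[m|z].
  rewrite dvdp_XsubCl /root hornerD hornerN subr_eq0.
  have -> : (p`_m).[c] = (\prod_i ('X - (lam i)%:P))`_m.
    by rewrite -pc coef_map.
  have -> : \prod_i ('X - (lam i)%:P) =
      map_poly (horner_eval c) (\prod_i ('X - ((polyC \o lam) i)%:P)).
    rewrite rmorph_prod; apply: eq_bigr => i _.
    by rewrite rmorphB /= map_polyX map_polyC /= /horner_eval hornerC.
  by rewrite coef_map.
move=> /(congr1 (map_poly (horner_eval c))).
rewrite rmorph0 rmorphD rmorphM /= map_polyC /= [horner_eval _ _]hornerXsubC.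
rewrite subrr polyC0 mul0r addr0 rmorph_prod /=.
move=> /esym/eqP/prodf_eq0[s _ /eqP Qs0].
exists s => C CCs.
have := congr1 (fun q : {poly F} => q`_(index C Cs)) Qs0.
rewrite QE rmorph_sum coef_sum coef0.
rewrite (bigD1 (Ordinal (etrans (index_mem C Cs) CCs)))//= big1 ?addr0.
  by rewrite rmorphM /= map_polyXn map_polyC coefMC coefXn eqxx mul1r nth_index.
move=> k kC; rewrite rmorphM /= map_polyXn map_polyC coefMC coefXn.
rewrite (_ : _ == _ = false) ?mul0r//.
by apply: contraNF kC => /eqP ek; apply/eqP/val_inj.
Qed.

(** * Spectrum on the centralizer of a regular derivation *)

Lemma uniq_nat_points (K : numFieldType) n : uniq [seq i%:R : K | i <- iota 0 n].
Proof. by rewrite map_inj_uniq ?iota_uniq//; apply: mulrIn; apply: oner_neq0. Qed.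

Lemma poly_eq0_points (K : numFieldType) (p : {poly K}) :
  (forall i, (i < size p)%N -> p.[i%:R] = 0) -> p = 0.
Proof.
move=> p0; apply/eqP; apply: contraT => pn0.
have := max_poly_roots pn0 _ (uniq_nat_points K (size p)).
rewrite size_map size_iota ltnn; apply.
by apply/allP => _ /mapP[i + ->]; rewrite mem_iota => /p0 /eqP.
Qed.

Lemma poly_horner_inj (K : numFieldType) (p q : {poly K}) :
  (forall c, p.[c] = q.[c]) -> p = q.
Proof.
move=> pq; apply/eqP; rewrite -subr_eq0; apply/eqP/poly_eq0_points => i _.
by rewrite hornerD hornerN pq subrr.
Qed.

Lemma horner_char_poly (R : comNzRingType) n (A : 'M[R]_n) c :
  (char_poly A).[c] = \det (c%:M - A).
Proof.
rewrite -[LHS]/(horner_eval c _) /char_poly -det_map_mx; congr (\det _).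
apply/matrixP => i j; rewrite !mxE /= /horner_eval hornerD hornerN hornerC.
by rewrite hornerMn hornerX.
Qed.

Lemma char_poly_diag (R : comNzRingType) n (s : 'rV[R]_n) :
  char_poly (diag_mx s) = \prod_i ('X - (s 0 i)%:P).
Proof.
rewrite char_poly_trig ?diag_mx_is_trig//.
by apply: eq_bigr => i _; rewrite mxE eqxx.
Qed.

Lemma char_poly_nilpotent (K : closedFieldType) n (N : 'M[K]_n) :
  nilpotent_mx N -> char_poly N = 'X^n.
Proof.
case: n N => [|n] N; first by rewrite /char_poly det_mx00.
move=> [k Nk]; have [r chN] := closed_field_poly_normal (char_poly N).
have := char_poly_monic N; rewrite monicE => /eqP lN.
rewrite lN scale1r in chN.
have r0 z : z \in r -> z = 0.
  move=> zr; have : eigenvalue N z.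
    by rewrite eigenvalue_root_char chN root_prod_XsubC.
  move=> /eigenvalueP[v vN v0].
  have vNk : v *m N ^+ k = z ^+ k *: v.
    elim: {Nk} k => [|k IHk]; first by rewrite !expr0 mulmx1 scale1r.
    by rewrite exprSr -mulmxE mulmxA IHk -scalemxAl vN scalerA exprSr.
  move: vNk; rewrite Nk mulmx0 => /esym/eqP.
  by rewrite scaler_eq0 (negPf v0) orbF expf_eq0 => /andP[_ /eqP].
have chX : char_poly N = 'X^(size r).
  rewrite chN big_seq (eq_bigr (fun=> 'X)) => [|z /r0->]; last by rewrite subr0.
  by rewrite -big_seq big_const_seq count_predT -Monoid.iteropE.
have := size_char_poly N; rewrite {1}chX size_polyXn => -[rn].
by rewrite chX rn.
Qed.

Lemma mxtrace_nilpotent (K : closedFieldType) n (N : 'M[K]_n) :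
  nilpotent_mx N -> \tr N = 0.
Proof.
case: n N => [|n] N nN; first by rewrite /mxtrace big_ord0.
have := char_poly_trace N (ltn0Sn n).
rewrite char_poly_nilpotent// coefXn /= ltn_eqF// => /eqP.
by rewrite eq_sym oppr_eq0 => /eqP.
Qed.

Lemma nilpotentM (K : fieldType) n (A N : 'M[K]_n) :
  comm_mx A N -> nilpotent_mx N -> nilpotent_mx (A *m N).
Proof.
move=> cAN [k Nk]; exists k.
by rewrite [A *m N]/(A * N) exprMn_comm// Nk mulr0.
Qed.

(** For c outside the spectrum of diag(s), c - diag(s) - N is the product of B
= c - diag(s) and of 1 - B^-1 N, which has determinant 1. *)
Lemma char_poly_diag_nilpotent (K : numClosedFieldType) n (s : 'rV[K]_n)
    (N : 'M[K]_n) :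
  comm_mx (diag_mx s) N -> nilpotent_mx N ->
  char_poly (diag_mx s + N) = char_poly (diag_mx s).
Proof.
move=> csN nN; pose q := char_poly (diag_mx s).
have q0 : q != 0 by rewrite monic_neq0// char_poly_monic.
apply: (mulIf q0); apply: poly_horner_inj => c; rewrite !hornerM.
have [->|qc] := eqVneq q.[c] 0; first by rewrite !mulr0.
congr (_ * _); rewrite !horner_char_poly.
pose B := c%:M - diag_mx s.
have Bu : B \in unitmx by rewrite unitmxE -horner_char_poly unitfE.
have cBN : comm_mx B N.
  by apply/comm_mx_sym/comm_mxB; [apply: comm_mx_scalar|apply/comm_mx_sym].
have cVN : comm_mx (invmx B) N.
  by rewrite /comm_mx -{1}[N](mulmxK Bu) -cBN !mulmxA mulVmx// mul1mx.
have -> : c%:M - (diag_mx s + N) = B *m (1%:M - invmx B *m N).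
  by rewrite mulmxBr mulmx1 mulKVmx// opprD addrA.
rewrite det_mulmx -(horner_char_poly _ 1) char_poly_nilpotent.
  by rewrite hornerXn expr1n mulr1.
exact: nilpotentM.
Qed.

(** The diagonal derivation t generates a maximal torus, in the sense that any
semisimple derivation which commutes with it is a function of it. *)
Definition is_regular (K : fieldType) (l : nat) (d : 'I_l -> nat)
    (G : tensor K d) (t : forall a, 'rV[K]_(d a)) : Prop :=
  is_der G (fun a => diag_mx (t a)) /\
  forall S : forall a, 'M[K]_(d a),
    is_der G S -> (forall a, diagonalizable (S a)) ->
    (forall a, comm_mx (S a) (diag_mx (t a))) ->
    exists s : forall a, 'rV[K]_(d a),
      (forall a, S a = diag_mx (s a)) /\
      forall a i j, t a 0 i = t a 0 j -> s a 0 i = s a 0 j.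

(** The average of the diagonal of x over the eigenspace of t that contains
the i-th basis vector. *)
Definition block_mean (R : unitRingType) n (T : eqType) (t : 'rV[T]_n)
    (x : 'M[R]_n) (i : 'I_n) : R :=
  (#|[pred j | t 0 j == t 0 i]|%:R)^-1 * \sum_(j | t 0 j == t 0 i) x j j.

Section Centralizer.
Variables (K : numClosedFieldType) (l : nat) (d : 'I_l -> nat) (G : tensor K d).
Variable (t : forall a, 'rV[K]_(d a)).
Hypothesis regt : is_regular G t.

(** By regularity the semisimple part of x is diag(s), with s constant on the
eigenspaces of t. The nilpotent part has trace 0 on each of them, so s is
found by averaging the diagonal of x. *)
Lemma centralizer_spectrum (x : forall a, 'M[K]_(d a)) :
  is_der G x -> (forall a i j, t a 0 i != t a 0 j -> x a i j = 0) ->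
  is_der G (fun a => diag_mx (\row_i block_mean (t a) (x a) i)) /\
  forall a, char_poly (x a) = \prod_i ('X - (block_mean (t a) (x a) i)%:P).
Proof.
move=> dx x0.
have cxt a : comm_mx (diag_mx (t a)) (x a).
  rewrite /comm_mx mul_mx_diag mul_diag_mx; apply/matrixP => i j; rewrite !mxE.
  have [->|tij] := eqVneq (t a 0 i) (t a 0 j); first by rewrite mulrC.
  by rewrite x0// mul0r mulr0.
have /fin_all_exists[S jcS] : forall a, exists S, jordan_chevalley (x a) S (x a - S).
  by move=> a; have [S []] := jordan_chevalley_exists (x a); exists S.
have [/uni_derivationP dS _] :=
  uni_derivation_jordan (iffRL (uni_derivationP G x) dx) jcS.
have [|a|s [Ss st]] := regt.2 S dS; first by move=> a; case: (jcS a).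
  by apply/comm_mx_sym/(jordan_chevalley_comm (jcS a)).
have ms a i : block_mean (t a) (x a) i = s a 0 i.
  have [_ _ nN cSN] := jcS a; pose N := x a - S a.
  (* The projector on the eigenspace of t; its product with N is nilpotent. *)
  pose e : 'rV[K]_(d a) := \row_j (t a 0 j == t a 0 i)%:R.
  have ceN : comm_mx (diag_mx e) N.
    rewrite /comm_mx mul_mx_diag mul_diag_mx; apply/matrixP => j k; rewrite !mxE.
    have [->|tjk] := eqVneq (t a 0 j) (t a 0 k); first by rewrite mulrC.
    rewrite x0// Ss !mxE (_ : (j == k) = false) ?subr0 ?mul0r ?mulr0//.
    by apply: contraNF tjk => /eqP ->.
  have /mxtrace_nilpotent := nilpotentM ceN nN.
  rewrite /mxtrace mul_diag_mx => tr0.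
  have xs : \sum_(j | t a 0 j == t a 0 i) x a j j =
            \sum_(j | t a 0 j == t a 0 i) s a 0 j.
    apply/eqP; rewrite -subr_eq0 -sumrB -[X in _ == X]tr0 big_mkcond.
    apply/eqP/eq_bigr => j _; rewrite !mxE Ss mxE eqxx.
    by case: eqP => _; rewrite ?mul1r ?mul0r.
  rewrite /block_mean xs (eq_bigr (fun=> s a 0 i)) => [|j /eqP /st//].
  rewrite sumr_const -[X in _ * X]mulr_natl mulrA mulVf ?mul1r//.
  by rewrite pnatr_eq0 -lt0n; apply/card_gt0P; exists i; rewrite inE.
split.
  move=> i; rewrite -(dS i); apply: eq_bigr => a _; congr (mode_act _ _ _).
  by rewrite Ss; congr diag_mx; apply/rowP => j; rewrite mxE ms.
move=> a; have [_ _ nN cSN] := jcS a.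
have -> : char_poly (x a) = char_poly (diag_mx (s a)).
  rewrite -(char_poly_diag_nilpotent (N := x a - S a)) -?Ss//.
  by rewrite addrC subrK.
by rewrite char_poly_diag; apply: eq_bigr => i _; rewrite ms.
Qed.

Definition poly_block_mean n (t : 'rV[K]_n) (z : 'M[{poly K}]_n) (i : 'I_n) :=
  ((#|[pred j | t 0 j == t 0 i]|%:R)^-1)%:P * \sum_(j | t 0 j == t 0 i) z j j.

Lemma horner_poly_block_mean n (u : 'rV[K]_n) (z : 'M[{poly K}]_n) i c :
  (poly_block_mean u z i).[c] = block_mean u (map_mx (horner_eval c) z) i.
Proof.
rewrite hornerM hornerC horner_sum; congr (_ * _).
by apply: eq_bigr => j _; rewrite mxE.
Qed.

(** Identities between polynomials, checked at every point c of the field,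
where [centralizer_spectrum] applies to the values at c. *)
Lemma centralizer_spectrum_poly (z : forall a, 'M[{poly K}]_(d a)) :
  is_der (polyC \o G) z -> (forall a i j, t a 0 i != t a 0 j -> z a i j = 0) ->
  (forall i, G i != 0 -> \sum_a poly_block_mean (t a) (z a) (i a) = 0) /\
  forall a, char_poly (z a) = \prod_i ('X - (poly_block_mean (t a) (z a) i)%:P).
Proof.
move=> dz z0; pose x c a := map_mx (horner_eval c) (z a).
have dx c : is_der G (x c).
  move=> i; have := lie_act_map (horner_eval c) (polyC \o G) z i.
  rewrite dz rmorph0 => <-; apply: eq_bigr => a _; apply: eq_bigr => j _.
  by rewrite /= /horner_eval hornerC.
have x0 c a i j : t a 0 i != t a 0 j -> x c a i j = 0.
  by move=> tij; rewrite mxE z0// /horner_eval horner0.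
have spec c := centralizer_spectrum (dx c) (x0 c).
split=> [i Gi|a].
  apply: poly_horner_inj => c; rewrite horner0 horner_sum.
  have [dm _] := spec c; have := dm i; rewrite lie_act_diag => /eqP.
  rewrite mulf_eq0 (negPf Gi) orbF => /eqP s0; rewrite -[RHS]s0.
  by apply: eq_bigr => a _; rewrite horner_poly_block_mean mxE.
apply/polyP => m; apply: poly_horner_inj => c.
rewrite -![_.[c]]/(horner_eval c _) -!coef_map; congr (polyseq _)`_m.
rewrite map_char_poly (spec c).2 rmorph_prod /=.
apply: eq_bigr => i _; rewrite rmorphB /= map_polyX map_polyC /=.
by rewrite [horner_eval c _]horner_poly_block_mean.
Qed.
End Centralizer.

(** * Spectrum of an arbitrary derivation *)

Lemma eqmod_coefP (K : fieldType) (q : {poly K}) (u v : {poly {poly K}}) :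
  eqmod q%:P u v <-> forall m, q %| u`_m - v`_m.
Proof.
split=> [[r ->] m|uv].
  by rewrite coefD addrC addKr coefCM dvdp_mulr.
exists (\poly_(m < size (u - v)) ((u - v)`_m %/ q)).
apply/polyP => m; rewrite coefD coefCM coef_poly.
case: ltnP => [_|/leq_sizeP/(_ m (leqnn m))].
  by rewrite coefB mulrC divpK ?uv// addrC subrK.
by rewrite coefB mulr0 addr0 => /eqP; rewrite subr_eq0 => /eqP.
Qed.

Lemma eqmod_horner (K : fieldType) (q : {poly K}) (u v : {poly {poly K}}) y :
  eqmod q%:P u v -> q %| u.[y] - v.[y].
Proof.
by move=> [r ->]; rewrite hornerD addrC addKr hornerM hornerC dvdp_mulr.
Qed.

(** The difference has degree below that of p and q. *)
Lemma monic_eq_points (K : numFieldType) (p q : {poly K}) :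
  p \is monic -> q \is monic -> size p = size q ->
  (forall i, (i < (size p).-1)%N -> p.[i%:R] = q.[i%:R]) -> p = q.
Proof.
move=> mp mq spq pq; apply/eqP; rewrite -subr_eq0; apply/eqP.
apply: poly_eq0_points => i si.
rewrite hornerD hornerN pq ?subrr//.
apply: leq_trans si _; rewrite -ltnS prednK; last first.
  by rewrite size_poly_gt0 monic_neq0.
have sp0 : (0 < size p)%N by rewrite size_poly_gt0 monic_neq0.
rewrite -(prednK sp0) ltnS; apply/leq_sizeP => j.
rewrite leq_eqVlt => /predU1P[<-|pj]; rewrite coefB.
  by move: mp mq; rewrite !monicE !lead_coefE spq => /eqP-> /eqP->; rewrite subrr.
have pj' : (size p <= j)%N by rewrite -(prednK sp0).
by rewrite !nth_default ?subrr// -spq.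
Qed.

Lemma size_prod_XsubC_ord (R : idomainType) m (f : 'I_m -> R) :
  size (\prod_i ('X - (f i)%:P)) = m.+1.
Proof.
rewrite size_prod_XsubC; congr _.+1.
by rewrite /index_enum; case: index_enum_key; rewrite -enumT -cardE card_ord.
Qed.

Section TorusSpectrum.
Variables (K : numClosedFieldType) (l : nat) (d : 'I_l -> nat) (G : tensor K d).
Variable (t : forall a, 'rV[K]_(d a)).
Hypothesis regt : is_regular G t.

Let J : finType := {a : 'I_l & 'I_(d a)}.
Let n := #|J|.
Let rk a (i : 'I_(d a)) : 'I_n := enum_rank (Tagged (fun a => 'I_(d a)) i).
Let flat (T : Type) (w : forall a, 'I_(d a) -> T) (k : 'I_n) : T :=
  let x : J := enum_val k in w (tag x) (tagged x).

Lemma flat_rk (T : Type) (w : forall a, 'I_(d a) -> T) a (i : 'I_(d a)) :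
  flat w (rk i) = w a i.
Proof. by rewrite /flat /rk enum_rankK. Qed.

Lemma prod_flat (R : comNzRingType) (T : Type) (w : forall a, 'I_(d a) -> T)
    (F : T -> R) :
  \prod_k F (flat w k) = \prod_a \prod_i F (w a i).
Proof.
rewrite (sig_big_dep _ _ (fun a i => F (w a i))) /=.
by rewrite [RHS](reindex _ (onW_bij _ (enum_val_bij J))).
Qed.

(** [specialize_root_relations] is applied to the path x = diag(t) + 'X (E -
diag(t)), which passes through E at 1, and to the product p of the
characteristic polynomials of all modes. Two kinds of relations are imposed on
the roots: the linear ones which say that they form a diagonal derivation, and
the equality of the product of the 'X - v_(a,i) with the characteristic
polynomial of mode a, at d_a points. The latter make each mode keep its
characteristic polynomial when the roots of p are permuted. *)
Lemma torus_spectrum (E : forall a, 'M[K]_(d a)) : is_der G E ->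
  exists v : forall a, 'rV[K]_(d a),
    is_der G (fun a => diag_mx (v a)) /\
    forall a, char_poly (E a) = \prod_i ('X - (v a 0 i)%:P).
Proof.
move=> dE.
pose x a : 'M[{poly K}]_(d a) := map_mx polyC (diag_mx (t a)) +
   'X *: (map_mx polyC (E a) - map_mx polyC (diag_mx (t a))).
have x1 a : map_mx (horner_eval 1) (x a) = E a.
  apply/matrixP => i j; rewrite !mxE /horner_eval.
  rewrite hornerD hornerM hornerX hornerD hornerN !hornerC mul1r.
  by rewrite addrC subrK.
have /fin_all_exists[lam lamE] a : exists lam : 'I_(d a) -> K,
    char_poly (E a) = \prod_i ('X - (lam i)%:P).
  have [r chE] := closed_field_poly_normal (char_poly (E a)).
  have := char_poly_monic (E a); rewrite monicE => /eqP lE.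
  rewrite lE scale1r in chE.
  have sr : size r = d a.
    by have := size_char_poly (E a); rewrite chE size_prod_XsubC => -[].
  exists (fun i => nth 0 r i).
  by rewrite chE (big_nth 0) big_mkord sr.
pose p : {poly {poly K}} := \prod_a char_poly (x a).
pose lin (i : multi_index d) : {mpoly {poly K}[n]} := \sum_a 'X_(rk (i a)).
pose chr a (y : nat) : {mpoly {poly K}[n]} :=
  \prod_(i : 'I_(d a)) ((y%:R%:P)%:MP - 'X_(rk i)) -
  ((char_poly (x a)).[y%:R%:P])%:MP.
pose Cs := [seq lin i | i <- enum [pred i : multi_index d | G i != 0]] ++
           [seq chr a y | a <- enum 'I_l, y <- iota 0 (d a)].
have linE i (v : 'I_n -> {poly K}) : (lin i).@[v] = \sum_a v (rk (i a)).
  by rewrite raddf_sum; apply: eq_bigr => a _; rewrite /= mevalXU.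
have chrE a y (v : 'I_n -> {poly K}) : (chr a y).@[v] =
    (\prod_(i : 'I_(d a)) ('X - (v (rk i))%:P)).[y%:R%:P] -
    (char_poly (x a)).[y%:R%:P].
  rewrite mevalB mevalC rmorph_prod horner_prod; congr (_ - _).
  by apply: eq_bigr => i _; rewrite /= mevalB mevalC mevalXU hornerXsubC.
have [||s sC] := @specialize_root_relations K n p Cs (flat lam) 1.
- move=> N; have [z [dz z0 xz]] := centralizer_normal_form regt.1 N dE.
  have [wlin wchr] := centralizer_spectrum_poly regt dz z0.
  pose w a i := poly_block_mean (t a) (z a) i.
  have xz' a : eqmod ('X^N)%:P (char_poly (x a)) (char_poly (z a)).
    by apply/eqmod_coefP/xz.
  exists (flat w); split.
    apply/eqmod_coefP; rewrite (prod_flat w (fun c => 'X - c%:P)).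
    by apply: eqmod_prod => a _; rewrite -wchr.
  move=> C; rewrite mem_cat => /orP[/mapP[i + ->]|/allpairsPdep[a [y [_ _ ->]]]].
    rewrite mem_enum linE => Gi; rewrite (eq_bigr (fun a => w a (i a))).
      by rewrite wlin.
    by move=> a _; rewrite flat_rk.
  rewrite chrE (eq_bigr (fun i => 'X - (w a i)%:P)); last first.
    by move=> i _; rewrite flat_rk.
  by rewrite -wchr; apply/eqmod_horner/eqmod_sym/xz'.
- rewrite (prod_flat lam (fun c => 'X - c%:P)) rmorph_prod /=.
  by apply: eq_bigr => a _; rewrite map_char_poly x1 lamE.
pose v a i := flat lam (s (rk (i : 'I_(d a)))).
exists (fun a => \row_i v a i); split.
  move=> i; rewrite lie_act_diag; have [->|Gi] := eqVneq (G i) 0.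
    by rewrite mulr0.
  have Ci : lin i \in Cs by rewrite mem_cat map_f// mem_enum.
  have := sC _ Ci; rewrite linE horner_sum => s0.
  rewrite -[RHS](mul0r (G i)) -[X in _ = X * _]s0; congr (_ * _).
  by apply: eq_bigr => a _; rewrite mxE hornerC.
move=> a; symmetry; apply: monic_eq_points.
- exact: monic_prod_XsubC.
- exact: char_poly_monic.
- by rewrite size_char_poly size_prod_XsubC_ord.
move=> y; rewrite size_prod_XsubC_ord /= => yd.
have Cy : chr a y \in Cs.
  rewrite mem_cat; apply/orP; right; apply/allpairsPdep.
  by exists a, y; rewrite mem_enum mem_iota.
have := sC _ Cy; rewrite chrE hornerD hornerN => /eqP.
rewrite subr_eq0 => /eqP.
have evE (u : {poly {poly K}}) :
    (u.[y%:R%:P]).[1] = (map_poly (horner_eval 1) u).[y%:R].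
  by rewrite -[LHS]/(horner_eval 1 _) -horner_map /= {2}/horner_eval hornerC.
rewrite !evE map_char_poly x1 => <-; congr (_.[_]).
rewrite rmorph_prod; apply: eq_bigr => i _.
by rewrite /= rmorphB /= map_polyX map_polyC /= /horner_eval hornerC mxE.
Qed.
End TorusSpectrum.

(** * Regular derivations and conjugacy *)

Lemma prod_XsubC_perm (F : fieldType) n (f g : 'I_n -> F) :
  \prod_i ('X - (f i)%:P) = \prod_i ('X - (g i)%:P) ->
  exists s : 'S_n, f =1 g \o s.
Proof.
have prodE (h : 'I_n -> F) :
    \prod_(x <- [tuple h i | i < n]) ('X - x%:P) = \prod_i ('X - (h i)%:P).
  by rewrite big_tuple; apply: eq_bigr => i _; rewrite tnth_mktuple.
move=> fg; have : perm_eq [tuple f i | i < n] [tuple g i | i < n].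
  by apply: prod_XsubC_eq; rewrite !prodE.
move=> /tuple_permP[s fs]; exists s => i.
have := congr1 (fun u => nth (f i) u i) fs.
by rewrite -!tnth_nth !tnth_mktuple.
Qed.

Lemma diag_mx_perm (F : fieldType) n (t : 'rV[F]_n) (s : 'S_n) :
  diag_mx (\row_i t 0 (s i)) = perm_mx s *m diag_mx t *m invmx (perm_mx s).
Proof.
apply: (canRL (mulmxK (unitmx_perm _ s))).
rewrite mul_mx_diag mul_diag_mx; apply/matrixP => i j; rewrite !mxE.
by case: eqP => [->|_]; rewrite ?mul1r ?mulr1 ?mul0r ?mulr0.
Qed.

Lemma char_poly_conj (K : numFieldType) n (P A : 'M[K]_n) :
  P \in unitmx -> char_poly (invmx P *m A *m P) = char_poly A.
Proof.
move=> Pu; apply: poly_horner_inj => c; rewrite !horner_char_poly.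
have -> : c%:M - invmx P *m A *m P = invmx P *m (c%:M - A) *m P.
  by rewrite mulmxBr mulmxBl mul_mx_scalar -scalemxAl mulVmx// scalemx1.
by rewrite !det_mulmx det_inv mulrAC mulVf ?mul1r// -unitfE -unitmxE.
Qed.

(** A common eigenbasis of the three matrices, reordered so that the
eigenvalues of diag(t) appear in the order of t. *)
Lemma codiagonalize_diag (K : numFieldType) n (t : 'rV[K]_n) (B C : 'M[K]_n) :
  diagonalizable B -> diagonalizable C ->
  comm_mx (diag_mx t) B -> comm_mx (diag_mx t) C -> comm_mx B C ->
  exists Q : 'M[K]_n, [/\ Q \in unitmx, diag_mx t = invmx Q *m diag_mx t *m Q,
    exists b, B = invmx Q *m diag_mx b *m Q &
    exists c, C = invmx Q *m diag_mx c *m Q].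
Proof.
move=> dB dC ctB ctC cBC.
have [||Q [Qu dQ]] := @codiagonalizable_ex K n [:: diag_mx t; B; C].
- move=> X Y; rewrite !inE => /or3P[]/eqP-> /or3P[]/eqP->;
    by [apply: comm_mx_refl | | apply: comm_mx_sym].
- by move=> X; rewrite !inE => /or3P[]/eqP-> //; apply: diagonalizable_diag.
have [|u tu] := dQ (diag_mx t); first by rewrite inE eqxx.
have [|b Bb] := dQ B; first by rewrite !inE eqxx orbT.
have [|c Cc] := dQ C; first by rewrite !inE eqxx !orbT.
have [s us] : exists s : 'S_n, u 0 =1 t 0 \o s.
  by apply: prod_XsubC_perm; rewrite -!char_poly_diag tu char_poly_conj.
pose R := perm_mx s : 'M[K]_n; have Ru : R \in unitmx by apply: unitmx_perm.
have conj (w : 'rV[K]_n) :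
    invmx Q *m diag_mx w *m Q =
    invmx (invmx R *m Q) *m diag_mx (\row_i w 0 (s^-1 i)%g) *m (invmx R *m Q).
  have -> : diag_mx w = R *m diag_mx (\row_i w 0 (s^-1 i)%g) *m invmx R.
    by rewrite -diag_mx_perm; congr diag_mx; apply/rowP => i; rewrite !mxE permK.
  by rewrite invmx_mul ?unitmx_inv// invmxK !mulmxA.
exists (invmx R *m Q); split.
- by rewrite unitmx_mul unitmx_inv Ru.
- rewrite {1}tu conj; congr (_ *m diag_mx _ *m _).
  by apply/rowP => i; rewrite !mxE us /= permKV.
- by rewrite Bb conj; eexists.
- by rewrite Cc conj; eexists.
Qed.

(** Each i with Q i != 0 excludes a single value of c. *)
Lemma generic_shift (K : numFieldType) (I : finType) (P Q : I -> K) :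
  exists c : K, forall i, P i + c * Q i = 0 -> P i = 0 /\ Q i = 0.
Proof.
pose p := \prod_(i | Q i != 0) ((P i)%:P + Q i *: 'X).
have p0 : p != 0.
  apply/prodf_neq0 => i Qi; apply: contraNneq Qi => /(congr1 (fun p : {poly K} => p`_1)).
  by rewrite coefD coefC coefZ coefX add0r mulr1 coef0 => ->.
have [c pc] : exists c, p.[c] != 0.
  apply: contrapT => pc; case/eqP: p0; apply: poly_horner_inj => c.
  by rewrite horner0; apply/eqP; apply: contrapT => /negP pcn; apply: pc; exists c.
exists c => i; have [->|Qi] := eqVneq (Q i) 0; first by rewrite mulr0 addr0.
move: pc; rewrite horner_prod => /prodf_neq0/(_ i Qi).
by rewrite hornerD hornerC hornerZ hornerX mulrC => /eqP.
Qed.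

Section MaximalTorus.
Variables (K : numClosedFieldType) (l : nat) (d : 'I_l -> nat).

Lemma change_basis_comp (G : tensor K d) (P Q : forall a, 'M[K]_(d a)) :
  change_basis (change_basis G P) Q = change_basis G (fun a => P a *m Q a).
Proof.
apply: functional_extensionality_dep => i.
rewrite {1}/change_basis tensor_form_change_basis; congr tensor_form.
by apply: functional_extensionality_dep => a; rewrite !colE mulmxA.
Qed.

(** The dimension of the centralizer of diag(t) in the product of the matrix
algebras. *)
Definition coincidences (t : forall a, 'rV[K]_(d a)) : nat :=
  \sum_a #|[set p : 'I_(d a) * 'I_(d a) | (t a 0 p.1 == t a 0 p.2)%R]|.

(** If S separated two basis vectors in one eigenspace of t, then t + c S, for
generic c, would have strictly fewer coincidences than t, in a basis which
also diagonalizes delta. The matrix delta stands for the given derivation D in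
the current basis. *)
Lemma refine_torus (G : tensor K d) (t delta : forall a, 'rV[K]_(d a))
    (S : forall a, 'M[K]_(d a)) :
  (forall (Q : forall a, 'M[K]_(d a)) (t' delta' : forall a, 'rV[K]_(d a)),
     (forall a, Q a \in unitmx) ->
     is_der (change_basis G Q) (fun a => diag_mx (t' a)) ->
     (forall a, diag_mx (delta a) = Q a *m diag_mx (delta' a) *m invmx (Q a)) ->
     (coincidences t <= coincidences t')%N) ->
  is_der G (fun a => diag_mx (t a)) -> is_der G S ->
  (forall a, diagonalizable (S a)) ->
  (forall a, comm_mx (diag_mx (t a)) (S a)) ->
  (forall a, comm_mx (diag_mx (delta a)) (S a)) ->
  exists s : forall a, 'rV[K]_(d a),
      (forall a, S a = diag_mx (s a)) /\
      forall a i j, t a 0 i = t a 0 j -> s a 0 i = s a 0 j.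
Proof.
move=> tmin dt dS diS ctS cdS.
have /fin_all_exists[Q /all_and4[Qu tQ /fin_all_exists[delta' dQ]
    /fin_all_exists[s SQ]]] : forall a, exists Q : 'M[K]_(d a),
    [/\ Q \in unitmx, diag_mx (t a) = invmx Q *m diag_mx (t a) *m Q,
      exists b, diag_mx (delta a) = invmx Q *m diag_mx b *m Q &
      exists c, S a = invmx Q *m diag_mx c *m Q].
  move=> a; apply: codiagonalize_diag => //; last exact: diag_mx_comm.
  exact: diagonalizable_diag.
pose J : finType := {a : 'I_l & ('I_(d a) * 'I_(d a))%type}.
have [c cP] := generic_shift
  (fun x : J => t (tag x) 0 (tagged x).1 - t (tag x) 0 (tagged x).2)
  (fun x : J => s (tag x) 0 (tagged x).1 - s (tag x) 0 (tagged x).2).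
pose t' a := t a + c *: s a.
have t'P a i j : t' a 0 i = t' a 0 j -> t a 0 i = t a 0 j /\ s a 0 i = s a 0 j.
  move=> /eqP; rewrite !mxE -subr_eq0 opprD addrACA -mulrBr => /eqP.
  move=> /(cP (Tagged (fun a => ('I_(d a) * 'I_(d a))%type) (i, j)))[] /=.
  by move=> /eqP + /eqP; rewrite !subr_eq0 => /eqP-> /eqP->.
have sub a : [set p : 'I_(d a) * 'I_(d a) | t' a 0 p.1 == t' a 0 p.2] \subset
             [set p | t a 0 p.1 == t a 0 p.2].
  by apply/subsetP => p; rewrite !inE => /eqP/t'P[-> _].
have le : (coincidences t <= coincidences t')%N.
  apply: (tmin (fun a => invmx (Q a)) t' delta').
  - by move=> a; rewrite unitmx_inv.
  - apply/uni_derivationP.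
    have -> : (fun a => diag_mx (t' a)) =
        fun a => invmx (invmx (Q a)) *m (diag_mx (t a) + c *: S a) *m invmx (Q a).
      apply: functional_extensionality_dep => a.
      rewrite invmxK tQ SQ scalemxAl scalemxAr -mulmxDl -mulmxDr.
      rewrite !mulmxA mulmxV// mul1mx mulmxK// /t' -linearZ -linearD /=.
      by [].
    apply/uni_derivation_conj => [a|]; first by rewrite unitmx_inv.
    by apply/uni_derivationP/is_derD => //; apply: is_derZ.
  - by move=> a; rewrite invmxK.
have eqc a : [set p : 'I_(d a) * 'I_(d a) | t' a 0 p.1 == t' a 0 p.2] =
             [set p | t a 0 p.1 == t a 0 p.2].
  apply/eqP; rewrite eqEcard sub /= leqNgt; apply/negP => lt.
  move: le; rewrite leqNgt => /negP; apply.
  rewrite /coincidences (bigD1 a)//= [X in (_ < X)%N](bigD1 a)//= -addSn.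
  by apply: leq_add => //; apply: leq_sum => b _; apply: subset_leq_card.
have st a i j : t a 0 i = t a 0 j -> s a 0 i = s a 0 j.
  move=> tij; have : (i, j) \in [set p | t a 0 p.1 == t a 0 p.2].
    by rewrite inE /= tij.
  by rewrite -eqc inE => /eqP/t'P[].
exists s; split=> // a; rewrite SQ -mulmxA.
suff -> : diag_mx (s a) *m Q a = Q a *m diag_mx (s a) :> 'M_(d a).
  by rewrite mulKmx.
have : diag_mx (t a) *m Q a = Q a *m diag_mx (t a).
  by rewrite [X in _ = _ *m X]tQ -!mulmxA mulKVmx.
rewrite !mul_mx_diag !mul_diag_mx => /matrixP tQa; apply/matrixP => i j.
have := tQa i j; rewrite !mxE.
have [/st ->|tij] := eqVneq (t a 0 i) (t a 0 j); first by move=> _; rewrite mulrC.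
rewrite [RHS]mulrC => /eqP; rewrite -subr_eq0 -mulrBl mulf_eq0 subr_eq0.
by rewrite (negPf tij) => /eqP ->; rewrite mulr0 mul0r.
Qed.

(** Among the bases where D is diagonal and the diagonal derivations in them,
take one with the fewest coincidences. [refine_torus], applied first to D
itself, shows that D is constant on the eigenspaces of t; so whatever commutes
with t commutes with D, and [refine_torus] applies to every S. *)
Lemma exists_regular (G : tensor K d) (D : forall a, 'M[K]_(d a)) :
  uni_derivation G D -> (forall a, diagonalizable (D a)) ->
  exists (P : forall a, 'M[K]_(d a)) (t delta : forall a, 'rV[K]_(d a)),
    [/\ forall a, P a \in unitmx, is_regular (change_basis G P) t &
        forall a, D a = P a *m diag_mx (delta a) *m invmx (P a)].
Proof.
move=> dD diD.
pose good (P : forall a, 'M[K]_(d a)) (t delta : forall a, 'rV[K]_(d a)) :=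
  [/\ forall a, P a \in unitmx,
      is_der (change_basis G P) (fun a => diag_mx (t a)) &
      forall a, D a = P a *m diag_mx (delta a) *m invmx (P a)].
have [P [t [delta [gP minP]]]] : exists P t delta, good P t delta /\
    forall P' t' delta', good P' t' delta' ->
      (coincidences t <= coincidences t')%N.
  have [P [t [delta gP]]] : exists P t delta, good P t delta.
    have /fin_all_exists[Q /all_and2[Qu /fin_all_exists[delta DQ]]] :
        forall a, exists Q : 'M[K]_(d a), Q \in unitmx /\
          exists u : 'rV[K]_(d a), D a = invmx Q *m diag_mx u *m Q.
      by move=> a; apply/diagonalizable_ex.
    exists (fun a => invmx (Q a)), delta, delta; split=> [a||a].
    - by rewrite unitmx_inv.
    - have -> : (fun a => diag_mx (delta a)) =
          fun a => invmx (invmx (Q a)) *m D a *m invmx (Q a).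
        apply: functional_extensionality_dep => a.
        by rewrite invmxK DQ !mulmxA mulmxV// mul1mx mulmxK.
      apply/uni_derivationP/uni_derivation_conj => // a.
      by rewrite unitmx_inv.
    - by rewrite invmxK.
  have [n nt] := ubnP (coincidences t).
  elim: n P t delta gP nt => // n IHn P t delta gP nt.
  have [min|] := pselect (forall P' t' delta', good P' t' delta' ->
      (coincidences t <= coincidences t')%N).
    by exists P, t, delta.
  move=> /existsNP[P' /existsNP[t' /existsNP[delta' /not_implyP[gP' /negP]]]].
  rewrite -ltnNge => lt; apply: (IHn P' t' delta' gP').
  exact: leq_trans lt nt.
have [Pu dt DP] := gP; exists P, t, delta; split=> //.
have DG : is_der (change_basis G P) (fun a => diag_mx (delta a)).
  have -> : (fun a => diag_mx (delta a)) = fun a => invmx (P a) *m D a *m P a.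
    apply: functional_extensionality_dep => a.
    by rewrite DP !mulmxA mulVmx// mul1mx mulmxKV.
  exact/uni_derivationP/uni_derivation_conj.
have tmin (Q : forall a, 'M[K]_(d a)) (t' delta' : forall a, 'rV[K]_(d a)) :
    (forall a, Q a \in unitmx) ->
    is_der (change_basis (change_basis G P) Q) (fun a => diag_mx (t' a)) ->
    (forall a, diag_mx (delta a) = Q a *m diag_mx (delta' a) *m invmx (Q a)) ->
    (coincidences t <= coincidences t')%N.
  rewrite change_basis_comp => Qu dt' dQ.
  apply: (minP (fun a => P a *m Q a) t' delta'); split=> // a.
    by rewrite unitmx_mul Pu Qu.
  by rewrite DP dQ invmx_mul// !mulmxA.
have [|||s [ds st]] := refine_torus tmin dt DG.
- by move=> a; apply: diagonalizable_diag.
- by move=> a; apply: diag_mx_comm.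
- by move=> a; apply: diag_mx_comm.
have sE a : delta a = s a.
  apply/rowP => i; have /matrixP/(_ i i) := ds a.
  by rewrite !mxE eqxx.
split=> // S dS diS cSt; apply: (refine_torus tmin dt dS diS) => a.
  exact/comm_mx_sym.
have := cSt a; rewrite /comm_mx !mul_mx_diag !mul_diag_mx => /matrixP St.
apply/matrixP => i j; have := St i j; rewrite !mxE sE.
have [/st ->|tij] := eqVneq (t a 0 i) (t a 0 j); first by move=> _; rewrite mulrC.
move=> /eqP; rewrite [X in X == _]mulrC eq_sym -subr_eq0 -mulrBl mulf_eq0 subr_eq0.
by rewrite (negPf tij) => /eqP ->; rewrite mulr0 mul0r.
Qed.

(** [torus_spectrum] gives a diagonal derivation V with the characteristic
polynomials of E. Since V_a and E_a are diagonalizable they are conjugate, and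
V commutes with D, as both are diagonal in the same basis. *)
Theorem torus_conjugacy (G : tensor K d) (D E : forall a, 'M[K]_(d a)) :
  uni_derivation G D -> uni_derivation G E ->
  (forall a, diagonalizable (D a)) -> (forall a, diagonalizable (E a)) ->
  exists X : forall a, 'M[K]_(d a),
    [/\ forall a, X a \in unitmx,
        uni_derivation G (fun a => invmx (X a) *m E a *m X a) &
        forall a, codiagonalizable [:: D a; invmx (X a) *m E a *m X a]].
Proof.
move=> dD dE diD diE.
have [P [t [delta [Pu regt DP]]]] := exists_regular dD diD.
have dE' : is_der (change_basis G P) (fun a => invmx (P a) *m E a *m P a).
  exact/uni_derivationP/uni_derivation_conj.
have [v [dv chE]] := torus_spectrum regt dE'.
have /fin_all_exists[Y /all_and2[Yu YE]] : forall a, exists Y : 'M[K]_(d a),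
    Y \in unitmx /\ diag_mx (v a) = invmx Y *m E a *m Y.
  move=> a; have /diagonalizable_ex[Q [Qu [lam EQ]]] := diE a.
  have [s vs] : exists s : 'S_(d a), v a 0 =1 lam 0 \o s.
    apply: prod_XsubC_perm; rewrite -chE -char_poly_diag char_poly_conj//.
    by rewrite EQ char_poly_conj.
  have -> : v a = \row_i lam 0 (s i) by apply/rowP => i; rewrite mxE vs.
  rewrite diag_mx_perm EQ; exists (invmx Q *m invmx (perm_mx s)).
  have Ru : (perm_mx s : 'M[K]_(d a)) \in unitmx by apply: unitmx_perm.
  rewrite unitmx_mul !unitmx_inv Qu Ru; split=> //.
  rewrite invmx_mul ?unitmx_inv// !invmxK !mulmxA mulmxK//.
  by rewrite mulmxK.
have XE a : invmx (Y a *m invmx (P a)) *m E a *m (Y a *m invmx (P a)) =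
    P a *m diag_mx (v a) *m invmx (P a).
  by rewrite YE invmx_mul ?unitmx_inv// invmxK !mulmxA.
exists (fun a => Y a *m invmx (P a)); split=> [a||a].
- by rewrite unitmx_mul Yu unitmx_inv Pu.
- apply/(uni_derivation_conj G _ Pu)/uni_derivationP.
  have -> : (fun a => invmx (P a) *m (invmx (Y a *m invmx (P a)) *m E a *m
      (Y a *m invmx (P a))) *m P a) = fun a => diag_mx (v a); last by [].
  apply: functional_extensionality_dep => a.
  by rewrite XE !mulmxA mulVmx// mul1mx mulmxKV.
apply/codiagonalizableP; rewrite XE DP; split.
  move=> A B; rewrite !inE => /orP[]/eqP-> /orP[]/eqP->.
  - exact: comm_mx_refl.
  - by rewrite /comm_mx !mulmxA !mulmxKV// -!(mulmxA (P a)) diag_mxC.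
  - by rewrite /comm_mx !mulmxA !mulmxKV// -!(mulmxA (P a)) diag_mxC.
  - exact: comm_mx_refl.
move=> A; rewrite !inE => /orP[]/eqP->; apply: diagonalizable_conj => //;
  exact: diagonalizable_diag.
Qed.

End MaximalTorus.

Theorem theorem9p2 (R : realType) (l : nat) (d : 'I_l -> nat)
    (Gamma : tensor R[i] d) :
  (forall D : forall a : 'I_l, 'M[R[i]]_(d a), uni_derivation Gamma D ->
     [/\ forall a : 'I_l, exists S N : 'M[R[i]]_(d a),
           jordan_chevalley (D a) S N,
         forall (a : 'I_l) (S N S' N' : 'M[R[i]]_(d a)),
           jordan_chevalley (D a) S N -> jordan_chevalley (D a) S' N' ->
           exists X : 'M[R[i]]_(d a),
             [/\ X \in unitmx, S' = invmx X *m S *m X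
               & N' = invmx X *m N *m X]
       & forall S N : forall a : 'I_l, 'M[R[i]]_(d a),
           (forall a : 'I_l, jordan_chevalley (D a) (S a) (N a)) ->
           uni_derivation Gamma S /\ uni_derivation Gamma N])
  /\
  (forall D E : forall a : 'I_l, 'M[R[i]]_(d a),
     uni_derivation Gamma D -> uni_derivation Gamma E ->
     (forall a : 'I_l, diagonalizable (D a)) ->
     (forall a : 'I_l, diagonalizable (E a)) ->
     exists X : forall a : 'I_l, 'M[R[i]]_(d a),
       [/\ forall a : 'I_l, X a \in unitmx,
           uni_derivation Gamma (fun a => invmx (X a) *m E a *m X a)
         & forall a : 'I_l,
             codiagonalizable [:: D a; invmx (X a) *m E a *m X a]]).
Proof.
split=> [D dD|D E]; last exact: torus_conjugacy.
split=> [a|a S N S' N' jc jc'|S N jc].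
- by have [S [jc _]] := jordan_chevalley_exists (D a); exists S, (D a - S).
- have [-> ->] := jordan_chevalley_unique jc jc'.
  by exists 1%:M; rewrite unitmx1 invmx1 !mul1mx !mulmx1.
- exact: uni_derivation_jordan dD jc.
Qed.
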